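(* There is a function $f$, computable in polynomial time with $f(I)$ bounded by a polynomial in $|I|$ for every X3C instance $I$, such that every X3C instance $I$ can be reduced in polynomial time to a Possible Winner instance for any scoring vector $(\alpha_1,\dots,\alpha_m)$ of size $m=f(I)+2$ satisfying $\alpha_1>\alpha_2=\alpha_{m-1}>\alpha_m=0$ and $\alpha_1>2\alpha_2$; i.e., one can construct in polynomial time a set of $m$ candidates, a list of partial votes and a distinguished candidate $c$ such that $c$ is a possible winner with respect to this vector iff $I$ is a yes-instance.
   Context: A scoring vector is $(\alpha_1,\dots,\alpha_m)$ with integers $\alpha_1\ge\dots\ge\alpha_m$; the candidate at position $j$ of a linear order gets $\alpha_j$ points. A partial vote is a transitive antisymmetric relation on the candidates; $c$ is a possible winner if some extension of all partial votes into linear orders gives $c$ maximum total score (the result also holds for the unique-winner variant). Exact Cover by 3-Sets (X3C): given a set $E$ and a family $\mathcal S$ of 3-element subsets of $E$, decide whether some subfamily covers each element of $E$ exactly once. *)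

(* Defs.v *)
From HB Require Import structures.
From Stdlib Require List.
From mathcomp Require Import all_boot all_order all_algebra.

Set Implicit Arguments.
Unset Strict Implicit.
Unset Printing Implicit Defensive.

Import Order.TTheory GRing.Theory Num.Theory.
Local Open Scope ring_scope.

(** * Polynomial time: deterministic multi-tape Turing machines *)

Inductive move := MoveL | MoveN | MoveR.

(** [None] is the blank, [inl] the input/output alphabet {0,1}, [inr] the
    additional work symbols. *)
Definition symbol (W : Type) := option (bool + W).

(** The machine has [tm_k.+1] tapes; [tm_delta] reads the scanned symbols and
    returns the next state and, for every tape, the symbol to write and the head
    move; it returns [None] when the machine halts. *)
Record tm := TM {
  tm_k : nat;
  tm_state : finType;
  tm_work : finType;
  tm_start : tm_state;
  tm_delta : tm_state -> ('I_tm_k.+1 -> symbol tm_work) ->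
             option (tm_state * ('I_tm_k.+1 -> symbol tm_work * move))
}.

(** Two-way infinite tape; cells are addressed relatively to the head, which
    scans cell 0. *)
Definition tape (W : Type) := int -> symbol W.

Definition tape_update (W : Type) (t : tape W) (a : symbol W * move) : tape W :=
  let t' (z : int) := if z == 0 then a.1 else t z in
  match a.2 with
  | MoveL => fun z => t' (z - 1)
  | MoveN => t'
  | MoveR => fun z => t' (z + 1)
  end.

Definition tape_of_word (W : Type) (w : seq bool) : tape W :=
  fun z => if z is Posz i then omap inl (onth w i) else None.

Definition config (M : tm) : Type :=
  (tm_state M * ('I_(tm_k M).+1 -> tape (tm_work M)))%type.

Definition tm_init (M : tm) (w : seq bool) : config M :=
  (tm_start M, fun i : 'I_(tm_k M).+1 => tape_of_word _ (if i == ord0 then w else [::])).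

Definition tm_step (M : tm) (c : config M) : option (config M) :=
  if tm_delta c.1 (fun i => c.2 i 0) is Some (q, a)
  then Some (q, fun i => tape_update (c.2 i) (a i)) else None.

(** The halting configuration reached from [c], if it is reached in at most [n]
    steps. *)
Fixpoint tm_run (M : tm) (n : nat) (c : config M) : option (config M) :=
  if tm_step c is Some c' then
    if n is n'.+1 then tm_run n' c' else None
  else Some c.

(** The output is the word on tape 0 from the head up to the first blank; the
    case [i = size w] is the blank. *)
Definition tm_output (M : tm) (c : config M) (w : seq bool) : Prop :=
  forall i : nat, (i <= size w)%N -> c.2 ord0 i%:Z = omap inl (onth w i).

(** [F] is computable in polynomial time on the inputs satisfying [D], with
    respect to the encodings [eA] and [eB]. *)
Definition polytime_on (A B : Type) (eA : A -> seq bool) (eB : B -> seq bool)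
    (D : A -> Prop) (F : A -> B) : Prop :=
  exists (M : tm) (p : {poly nat}), forall x, D x ->
    exists2 c, tm_run p.[size (eA x)] (tm_init M (eA x)) = Some c
             & tm_output c (eB (F x)).

(** * Self-delimiting encodings as bit strings *)

Definition enc_seq (A : Type) (e : A -> seq bool) (s : seq A) : seq bool :=
  flatten [seq true :: e x | x <- s] ++ [:: false].

Definition enc_unary (n : nat) : seq bool := rcons (nseq n true) false.

(** Binary digits, least significant first; [up_log 2 n.+1] is the bit length
    of [n]. *)
Definition bits (n : nat) : seq bool :=
  mkseq (fun i => odd (n %/ 2 ^ i)) (up_log 2 n.+1).

Definition enc_nat (n : nat) : seq bool := enc_seq (fun b => [:: b]) (bits n).

Definition enc_int (z : int) : seq bool := (z < 0) :: enc_nat `|z|%N.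

Definition enc_vector (alpha : seq int) : seq bool := enc_seq enc_int alpha.

(** * Exact Cover by 3-Sets *)

(** The ground set E is {0, ..., x3c_n - 1}. *)
Record x3c := X3C {
  x3c_n : nat;
  x3c_sets : seq {set 'I_x3c_n};
  x3c_card3 : all (fun S : {set 'I_x3c_n} => #|S| == 3%N) x3c_sets
}.

Definition x3c_yes (I : x3c) : Prop :=
  exists2 T : seq {set 'I_(x3c_n I)}, subseq T (x3c_sets I)
    & forall e : 'I_(x3c_n I),
        count (fun S : {set 'I_(x3c_n I)} => e \in S) T = 1%N.

(** The ground set is given explicitly, hence [x3c_n] in unary, so that |I| is
    at least |E|; every set is given by its characteristic vector. *)
Definition enc_x3c (I : x3c) : seq bool :=
  enc_unary (x3c_n I) ++
  enc_seq (fun S : {set 'I_(x3c_n I)} => [seq e \in S | e <- enum 'I_(x3c_n I)])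
          (x3c_sets I).

(** * Possible Winner *)

(** [v x y] means that [x] is preferred to [y]. *)
Record partial_vote (m : nat) := PartialVote {
  pv_rel :> rel 'I_m;
  pv_trans : transitive pv_rel;
  pv_antisym : antisymmetric pv_rel
}.

Record pw := PW {
  pw_m : nat;
  pw_votes : seq (partial_vote pw_m);
  pw_c : 'I_pw_m
}.

Definition linear_order (m : nat) (L : rel 'I_m) : Prop :=
  [/\ reflexive L, antisymmetric L, transitive L & total L].

Definition linear_extension (m : nat) (v : partial_vote m) (L : rel 'I_m) : Prop :=
  linear_order L /\ subrel v L.

(** 0-based position: 0 is the most preferred candidate. *)
Definition position (m : nat) (L : rel 'I_m) (x : 'I_m) : nat :=
  #|[set y | (y != x) && L y x]|.

Definition score (m : nat) (alpha : seq int) (Ls : seq (rel 'I_m)) (x : 'I_m) : int :=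
  \sum_(L <- Ls) alpha`_(position L x).

Definition possible_winner (alpha : seq int) (P : pw) : Prop :=
  exists2 Ls : seq (rel 'I_(pw_m P)),
    List.Forall2 (@linear_extension _) (pw_votes P) Ls
    & forall x, score alpha Ls x <= score alpha Ls (pw_c P).

Definition enc_pw (P : pw) : seq bool :=
  enc_unary (pw_m P) ++
  enc_seq (fun v : partial_vote (pw_m P) =>
             [seq v x y | x <- enum 'I_(pw_m P), y <- enum 'I_(pw_m P)])
          (pw_votes P) ++
  enc_unary (pw_c P).

(** * Scoring vectors *)

Definition scoring_vector (m : nat) (alpha : seq int) : Prop :=
  size alpha = m /\ sorted (fun a b : int => b <= a) alpha.

(** alpha_j is [alpha`_(j - 1)]:
    alpha_1 > alpha_2 = alpha_(m-1) > alpha_m = 0 and alpha_1 > 2 alpha_2. *)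
Definition admissible_vector (m : nat) (alpha : seq int) : Prop :=
  [/\ scoring_vector m alpha,
      alpha`_0 > alpha`_1,
      alpha`_1 = alpha`_(m - 2),
      alpha`_(m - 2) > alpha`_(m - 1) /\ alpha`_(m - 1) = 0
    & alpha`_0 > 2 * alpha`_1].

(* Main.v *)
Require Import Defs.
From HB Require Import structures.
From Stdlib Require List.
From Stdlib Require Import FunctionalExtensionality.
From mathcomp Require Import all_boot all_order all_algebra zify.

Import Order.TTheory GRing.Theory Num.Theory.

(**
  Put b = alpha_2 and a = alpha_1 - alpha_2, so that a > b > 0. Up to a constant
  the score of x is a * first(x) - b * last(x), and a partial vote only matters
  through its sets of maximal and minimal candidates. Fixed votes give each
  candidate an arbitrary slack of the form a * i + b * j with respect to c, so
  the reduction does not look at alpha at all.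

  A set p has three candidates x, y, z with slack a - 2b, a - 2b and a - b before
  the following votes.
  - x is isolated between a top N and a bottom D: either x is first (the set is
    selected), or N is first and x may be last.
  - y is isolated between z and D in the same way.
  - c is first and one of x, z, D is last.
  For every element e there is a vote with c first whose last candidate is D, or
  x of a set with least element e, or y of a set containing e otherwise. If x is
  first, it has to be last twice elsewhere: in the third vote and in the vote of
  the least element. Then z is not last, so it cannot be first, y is first, and y
  has to be last in the votes of the two other elements. Hence the selected sets
  are disjoint. The slack of N forces at least |E|/3 of them to be selected. If x
  is not first, being last in its own vote is enough since a > b.

  The instance is definable from the input word by first-order formulas with
  addition, divisibility and quantifiers bounded by the length of the word.
  Such formulas are evaluated in polynomial time with unary counters: the
  position of a head on a copy of the input. The number of candidates is one more
  than a power of 2, which makes f(I) = 2^k - 1 a string of ones.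
*)

(** * Structured programs for multi-tape machines *)

(** A candidate with slack a - 2b that takes a first place owes two last places, while a selected
    set has to claim three element votes, so one candidate per set is not enough. The third vote of
    a set couples x to y through z: it absorbs one of the two debts of x, leaving one element to x,
    and it creates a debt of two for y, which makes 1 + 2 = 3 elements.

    A set is named by the position p of its tag bit in the input word. These positions are multiples
    of |E| + 1, hence at least 4 apart as soon as a set exists, so p, p + 1, p + 2 can serve as x,
    y, z; indices that name nothing are padding candidates that are never first.

    A register cannot exceed the length of the word. The vector is part of the input and contributes
    at least three bits per entry, which makes room for all candidate numbers. Repeated votes need
    definable index sets: the multiples of 3 below |E| provide |E|/3 rounded up, and the rounding is
    harmless because disjoint triples never number more than |E|/3. *)

Section Commands.
Variable k : nat.

Definition syms := 'I_k.+1 -> symbol bool.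
Definition acts := 'I_k.+1 -> symbol bool * move.
Definition tapes := 'I_k.+1 -> tape bool.

Inductive cmd :=
| Act of (syms -> acts)
| Seq of cmd & cmd
| If of (syms -> bool) & cmd & cmd
| While of (syms -> bool) & cmd.

Definition noop (s : syms) : acts := fun i => (s i, MoveN).

(** The extra state [None] of [If] and [While] is the one in which the test is evaluated. *)
Fixpoint state_of (c : cmd) : finType :=
  match c with
  | Act _ => unit
  | Seq c d => (state_of c + state_of d)%type
  | If _ c d => option (state_of c + state_of d)
  | While _ c => option (state_of c)
  end.

Fixpoint start_of (c : cmd) : state_of c :=
  match c return state_of c with
  | Act _ => tt
  | Seq c d => inl (start_of c)
  | If _ c d => None
  | While _ c => None
  end.

(* The next state [None] is the exit of the command. *)
Fixpoint delta (c : cmd) : state_of c -> syms -> option (state_of c) * acts :=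
  match c return state_of c -> syms -> option (state_of c) * acts with
  | Act a => fun _ s => (None, a s)
  | Seq c d => fun q s =>
      match q with
      | inl q => let: (r, a) := delta c q s in
                 (Some (if r is Some q' then inl q' else inr (start_of d)), a)
      | inr q => let: (r, a) := delta d q s in (omap inr r, a)
      end
  | If b c d => fun q s =>
      match q with
      | None => (Some (Some (if b s then inl (start_of c) else inr (start_of d))), noop s)
      | Some (inl q) => let: (r, a) := delta c q s in
                        (omap (fun q' => Some (inl q')) r, a)
      | Some (inr q) => let: (r, a) := delta d q s in
                        (omap (fun q' => Some (inr q')) r, a)
      end
  | While b c => fun q s =>
      match q with
      | None => (if b s then Some (Some (start_of c)) else None, noop s)
      | Some q => let: (r, a) := delta c q s in (Some r, a)
      end
  end.

Definition heads (t : tapes) : syms := fun i => t i 0%R.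
Definition update (t : tapes) (a : acts) : tapes := fun i => tape_update (t i) (a i).

Inductive steps (c : cmd) : option (state_of c) -> tapes -> nat -> option (state_of c) -> tapes -> Prop :=
| Steps0 q t : steps c q t 0 q t
| StepsS q t n r t' :
    steps c (delta c q (heads t)).1 (update t (delta c q (heads t)).2) n r t' ->
    steps c (Some q) t n.+1 r t'.

Lemma steps_trans c q1 t1 n1 q2 t2 n2 q3 t3 :
  steps c q1 t1 n1 q2 t2 -> steps c q2 t2 n2 q3 t3 ->
  steps c q1 t1 (n1 + n2) q3 t3.
Proof.
elim=> [q t|q t n r t' _ IH] H; first by [].
by rewrite addSn; apply: StepsS; apply: IH.
Qed.

(** A compound command simulates its parts: [h] places the states of the part inside the whole and
    decides what its exit becomes, for instance the start of the next command. The rules for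
    sequences, tests and loops are instances. *)
Lemma steps_embed c d (h : option (state_of c) -> option (state_of d)) (g : state_of c -> state_of d) :
  (forall q, h (Some q) = Some (g q)) ->
  (forall q s, delta d (g q) s = (h (delta c q s).1, (delta c q s).2)) ->
  forall q t n r t', steps c q t n r t' -> steps d (h q) t n (h r) t'.
Proof.
move=> hg hd q t n r t'; elim=> [q0 t0|q0 t0 n0 r0 t0' _ IH]; first exact: Steps0.
by rewrite hg; apply: StepsS; rewrite hd.
Qed.

Definition terminates (c : cmd) (t : tapes) (n : nat) (t' : tapes) :=
  exists2 n', n' <= n & steps c (Some (start_of c)) t n' None t'.

Lemma terminates_leq c t n n' t' :
  n <= n' -> terminates c t n t' -> terminates c t n' t'.
Proof. by move=> le_nn' [i le_in H]; exists i => //; apply: leq_trans le_nn'. Qed.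

Lemma update_noop (t : tapes) : update t (noop (heads t)) = t.
Proof.
apply: functional_extensionality => i; apply: functional_extensionality => z.
by rewrite /update /noop /tape_update /heads /=; case: eqP => // ->.
Qed.

Lemma terminates_act a t : terminates (Act a) t 1 (update t (a (heads t))).
Proof. by exists 1 => //; apply: StepsS; apply: Steps0. Qed.

Lemma terminates_seq c d t1 n1 t2 n2 t3 :
  terminates c t1 n1 t2 -> terminates d t2 n2 t3 ->
  terminates (Seq c d) t1 (n1 + n2) t3.
Proof.
case=> i le_i Hi [j le_j Hj]; exists (i + j); first exact: leq_add.
pose h (r : option (state_of c)) : option (state_of (Seq c d)) :=
  Some (if r is Some q' then inl q' else inr (start_of d)).
have H1 := @steps_embed c (Seq c d) h inl (fun=> erefl) _ _ _ _ _ _ Hi.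
have H2 := @steps_embed d (Seq c d) (omap inr) inr (fun=> erefl) _ _ _ _ _ _ Hj.
apply: steps_trans (H1 _) (H2 _) => q s /=; by case: delta.
Qed.

Lemma terminates_if (b : syms -> bool) c d t n t' :
  terminates (if b (heads t) then c else d) t n t' ->
  terminates (If b c d) t n.+1 t'.
Proof.
case=> i le_i Hi; exists i.+1 => //; apply: StepsS; rewrite /= update_noop.
case: (b (heads t)) Hi => Hi.
- have H := @steps_embed c (If b c d) (omap (fun q => Some (inl q)))
    (fun q => Some (inl q)) (fun=> erefl) _ _ _ _ _ _ Hi.
  by apply: H => q s /=; case: delta.
- have H := @steps_embed d (If b c d) (omap (fun q => Some (inr q)))
    (fun q => Some (inr q)) (fun=> erefl) _ _ _ _ _ _ Hi.
  by apply: H => q s /=; case: delta.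
Qed.

Lemma terminates_while_end (b : syms -> bool) c t : ~~ b (heads t) -> terminates (While b c) t 1 t.
Proof.
move=> nb; exists 1 => //; apply: StepsS => /=.
by rewrite update_noop (negbTE nb); apply: Steps0.
Qed.

Lemma terminates_while (b : syms -> bool) c t1 n1 t2 n2 t3 :
  b (heads t1) -> terminates c t1 n1 t2 -> terminates (While b c) t2 n2 t3 ->
  terminates (While b c) t1 (n1 + n2).+1 t3.
Proof.
move=> bt [i le_i Hi] [j le_j Hj]; exists (i + j).+1; first by rewrite ltnS leq_add.
apply: StepsS; rewrite /= update_noop bt.
have H := @steps_embed c (While b c) Some Some (fun=> erefl) _ _ _ _ _ _ Hi.
by apply: steps_trans (H _) Hj => q s /=; case: delta.
Qed.

Definition machine (c : cmd) : tm :=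
  @TM k (option (state_of c)) bool (Some (start_of c))
    (fun q s => if q is Some q then Some (delta c q s) else None).

(** Surplus steps are harmless because the machine halts in the state [None]. *)
Lemma machine_run c t n t' :
  terminates c t n t' ->
  tm_run n ((Some (start_of c), t) : config (machine c)) =
  Some ((None, t') : config (machine c)).
Proof.
case=> i le_i H; have -> : n = i + (n - i) by lia.
move: (n - i) => {le_i} {}n; move: H.
(* The final state becomes a variable, so that the induction on [steps] keeps it as an index. *)
have [r Er] : exists r, r = None :> option (state_of c) by exists None.
rewrite -{1}Er; move: (Some (start_of c)) => q H.
elim: H Er => [q0 t0 -> |q0 t0 i0 r0 t0' _ IH Er]; first by case: n.
rewrite -(IH Er) addSn /= /tm_step /=.
by case: (delta c q0 _).
Qed.

End Commands.

Arguments Act {k} _.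
Arguments Seq {k} _ _.
Arguments If {k} _ _ _.
Arguments While {k} _ _.
Arguments noop {k} _ _.
Arguments heads {k} _ _.
Arguments update {k} _ _ _.
Arguments terminates {k} _ _ _ _.
Arguments machine {k} _.
Arguments terminates_leq {k} _ _ _ _ _.
Arguments terminates_act {k} _ _.
Arguments terminates_seq {k c d t1 n1 t2 n2 t3}.
Arguments terminates_if {k b c d t n t'}.
Arguments terminates_while {k b c t1 n1 t2 n2 t3}.
Arguments terminates_while_end {k b c t}.
Arguments machine_run {k c t n t'}.

Set Implicit Arguments.
Unset Strict Implicit.
Unset Printing Implicit Defensive.

(** * Bounded formulas and their evaluation by head movements *)

Definition upd (env : nat -> nat) (r x : nat) : nat -> nat :=
  fun i => if i == r then x else env i.

Lemma upd_eq env r x : upd env r x r = x.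
Proof. by rewrite /upd eqxx. Qed.

Lemma upd_id env r x : env r = x -> upd env r x = env.
Proof.
by move=> Er; apply: functional_extensionality => i; rewrite /upd; case: eqP => // ->.
Qed.

(* Variables are register numbers. The quantifier ranges over 0, ..., [size w]. *)
Inductive fm :=
| FIn of bool & nat
| FZero of nat
| FAdd of nat & nat & nat
| FDiv of nat & nat
| FNot of fm
| FAnd of fm & fm
| FEx of nat & fm.

Fixpoint sat (w : seq bool) (env : nat -> nat) (f : fm) : bool :=
  match f with
  | FIn b r => onth w (env r) == Some b
  | FZero r => env r == 0
  | FAdd r s t => env r + env s == env t
  | FDiv r s => env r %| env s
  | FNot f => ~~ sat w env f
  | FAnd f g => sat w env f && sat w env g
  | FEx r f => has (fun x => sat w (upd env r x) f) (iota 0 (size w).+1)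
  end.

Inductive gen :=
| GEmit of bool
| GBit of fm
| GSeq of gen & gen
| GFor of nat & fm & gen.

Fixpoint out (w : seq bool) (env : nat -> nat) (g : gen) : seq bool :=
  match g with
  | GEmit b => [:: b]
  | GBit f => [:: sat w env f]
  | GSeq g h => out w env g ++ out w env h
  | GFor r f g =>
      flatten [seq if sat w (upd env r x) f then out w (upd env r x) g else [::]
              | x <- iota 0 (size w).+1]
  end.

(* Registers below [d] are in scope, the others are free scratch registers that
   hold 0; register [r] lives on tape [r], tape 0 being the output. *)
Fixpoint wf_fm (k d : nat) (f : fm) : bool :=
  match f with
  | FIn _ r | FZero r => (0 < r < d) && (d <= k)
  | FAdd r s t => [&& all (fun i => 0 < i < d) [:: r; s; t], uniq [:: r; s; t] & d < k]
  | FDiv r s => [&& all (fun i => 0 < i < d) [:: r; s], r != s & d < k]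
  | FNot f => wf_fm k d f
  | FAnd f g => wf_fm k d f && wf_fm k d g
  | FEx r f => [&& r == d, 0 < d, d < k & wf_fm k d.+1 f]
  end.

Fixpoint wf_gen (k d : nat) (g : gen) : bool :=
  match g with
  | GEmit _ => true
  | GBit f => wf_fm k d f
  | GSeq g h => wf_gen k d g && wf_gen k d h
  | GFor r f g => [&& r == d, 0 < d, d < k, wf_fm k d.+1 f & wf_gen k d.+1 g]
  end.

(** Cell 0 carries its bit under the tag [inr] and the blank behind the word marks position
    [size w], so a head position is a counter whose two ends are visible. *)
Definition cell (w : seq bool) (z : int) : symbol bool :=
  if z is Posz i then omap (if i == 0 then inr else inl) (onth w i) else None.

Definition ruler (w : seq bool) (p : nat) : tape bool := fun z => cell w (z + p%:Z)%R.

(** The scanned cell lies just behind the output [o] and doubles as the boolean result [fl] of the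
    last test; emitting that result is a mere move to the right. *)
Definition out_tape (o : seq bool) (fl : option bool) : tape bool :=
  fun z => if z == 0%R then omap inl fl else tape_of_word bool o (z + (size o)%:Z)%R.

Definition shift (d : nat -> move) (j : nat) (env : nat -> nat) : nat -> nat :=
  fun i => match d i with
           | MoveL => env i - j
           | MoveN => env i
           | MoveR => env i + j
           end.

Definition dir (ls rs : seq nat) (i : nat) : move :=
  if i \in ls then MoveL else if i \in rs then MoveR else MoveN.

(** * Compilation of formulas and generators to head movements *)

Section Registers.
Variable k : nat.
Notation syms := (syms k).
Notation acts := (acts k).
Notation cmd := (cmd k).

Definition amove (d : nat -> move) (s : syms) : acts :=
  fun i => (s i, if i == 0 :> nat then MoveN else d i).
Definition aflag (t : syms -> bool) (s : syms) : acts :=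
  fun i => (if i == 0 :> nat then Some (inl (t s)) else s i, MoveN).
Definition aemit (s : syms) : acts :=
  fun i => (s i, if i == 0 :> nat then MoveR else MoveN).

Definition at_zero (r : nat) (s : syms) : bool :=
  if s (inord r) is Some (inr _) then true else false.
Definition at_end (r : nat) (s : syms) : bool :=
  if s (inord r) is None then true else false.
Definition at_bit (b : bool) (r : nat) (s : syms) : bool :=
  match s (inord r) with Some (inl c) | Some (inr c) => c == b | None => false end.
Definition flag (s : syms) : bool :=
  if s ord0 is Some (inl b) then b else false.

Definition sweep (b : syms -> bool) (ls rs : seq nat) : cmd :=
  While b (Act (amove (dir ls rs))).

(** [t] is lowered together with [r], then together with [s]; the equation holds iff all three end
    at 0. [u] and [v] record the two amounts, and the last two sweeps undo them. *)
Definition add_code (r s t u v : nat) : cmd :=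
  Seq (sweep (fun y => ~~ at_zero r y && ~~ at_zero t y) [:: r; t] [:: u])
 (Seq (sweep (fun y => ~~ at_zero s y && ~~ at_zero t y) [:: s; t] [:: v])
 (Seq (Act (aflag (fun y => [&& at_zero r y, at_zero s y & at_zero t y])))
 (Seq (sweep (fun y => ~~ at_zero v y) [:: v] [:: s; t])
      (sweep (fun y => ~~ at_zero u y) [:: u] [:: r; t])))).

(** Repeated subtraction of [r] from [t]. The flag tells whether the last round removed a whole [r];
    [u] restores [r] after each round and [v] collects the total for restoring [t]. *)
Definition div_loop (r t u v : nat) : cmd :=
  While (fun y => ~~ at_zero t y && flag y)
    (Seq (sweep (fun y => ~~ at_zero r y && ~~ at_zero t y) [:: r; t] [:: u; v])
    (Seq (Act (aflag (at_zero r)))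
         (sweep (fun y => ~~ at_zero u y) [:: u] [:: r]))).

(** The initial flag is false only for r = 0 < t: then the answer is negative, and the loop, which
    would make no progress, is skipped. *)
Definition div_code (r t u v : nat) : cmd :=
  Seq (Act (aflag (fun y => ~~ at_zero r y || at_zero t y)))
 (Seq (div_loop r t u v)
      (sweep (fun y => ~~ at_zero v y) [:: v] [:: t])).

Fixpoint fm_code (d : nat) (f : fm) : cmd :=
  match f with
  | FIn b r => Act (aflag (at_bit b r))
  | FZero r => Act (aflag (at_zero r))
  | FAdd r s t => add_code r s t d d.+1
  | FDiv r t => div_code r t d d.+1
  | FNot f => Seq (fm_code d f) (Act (aflag (fun y => ~~ flag y)))
  | FAnd f g => Seq (fm_code d f) (If flag (fm_code d g) (Act noop))
  | FEx r f =>
      Seq (fm_code d.+1 f)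
     (Seq (While (fun y => ~~ flag y && ~~ at_end r y)
             (Seq (Act (amove (dir [::] [:: r]))) (fm_code d.+1 f)))
          (sweep (fun y => ~~ at_zero r y) [:: r] [::]))
  end.

Fixpoint gen_code (d : nat) (g : gen) : cmd :=
  match g with
  | GEmit b => Seq (Act (aflag (fun=> b))) (Act aemit)
  | GBit f => Seq (fm_code d f) (Act aemit)
  | GSeq g h => Seq (gen_code d g) (gen_code d h)
  | GFor r f g =>
      let body := Seq (fm_code d.+1 f) (If flag (gen_code d.+1 g) (Act noop)) in
      Seq body
     (Seq (While (fun y => ~~ at_end r y) (Seq (Act (amove (dir [::] [:: r]))) body))
          (sweep (fun y => ~~ at_zero r y) [:: r] [::]))
  end.

(** * Correctness and running time of the compiled code *)

Section Correctness.
Variable w : seq bool.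
Hypothesis w_gt0 : 0 < size w.
Notation N := (size w).

Definition conf (env : nat -> nat) (o : seq bool) (fl : option bool) : tapes k :=
  fun i => if i == 0 :> nat then out_tape o fl else ruler w (env i).

Lemma heads_ruler env o fl r : 0 < r <= k ->
  heads (conf env o fl) (inord r) = cell w (env r)%:Z.
Proof.
by case/andP=> r0 rk; rewrite /heads /conf inordK ?ltnS // eqn0Ngt r0 /= /ruler add0r.
Qed.

Lemma at_zeroE env o fl r : 0 < r <= k ->
  at_zero r (heads (conf env o fl)) = (env r == 0).
Proof.
move=> rk; rewrite /at_zero heads_ruler //=.
case: (env r) => [|i]; first by case: w w_gt0.
by rewrite /cell /=; case: (match w with [::] => _ | _ => _ end).
Qed.

Lemma at_endE env o fl r : 0 < r <= k ->
  at_end r (heads (conf env o fl)) = (N <= env r).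
Proof.
move=> rk; rewrite /at_end heads_ruler // /cell -onthNE.
by case: (onth w _).
Qed.

Lemma at_bitE env o fl b r : 0 < r <= k ->
  at_bit b r (heads (conf env o fl)) = (onth w (env r) == Some b).
Proof.
move=> rk; rewrite /at_bit heads_ruler // /cell.
by case: (onth w _) => [c|] //=; case: (env r).
Qed.

Lemma flagE env o b : flag (heads (conf env o (Some b))) = b.
Proof. by []. Qed.

Lemma amove_conf d env o fl : (forall i, d i = MoveL -> 0 < env i) ->
  update (conf env o fl) (amove d (heads (conf env o fl))) = conf (shift d 1 env) o fl.
Proof.
move=> dL; apply: functional_extensionality => i; apply: functional_extensionality => z.
rewrite /update /amove /heads /conf; case: (i =P 0 :> nat) => [_|_].
  by rewrite /tape_update /=; case: (z =P 0%R) => [->|].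
rewrite /tape_update /shift; case Ed: (d i) => /=.
- have Ei := dL _ Ed; rewrite /ruler; case: eqP => [E|_]; congr (cell _ _); lia.
- by case: eqP => [->|].
- rewrite /ruler; case: eqP => [E|_]; congr (cell _ _); lia.
Qed.

Lemma aflag_conf t env o fl :
  update (conf env o fl) (aflag t (heads (conf env o fl)))
  = conf env o (Some (t (heads (conf env o fl)))).
Proof.
apply: functional_extensionality => i; apply: functional_extensionality => z.
rewrite /update /aflag /heads /tape_update /=.
case: (z =P 0%R) => [->|]; rewrite /conf; case: (i =P 0 :> nat) => // _ z0.
by rewrite /out_tape; case: eqP.
Qed.

Lemma aemit_conf env o b :
  update (conf env o (Some b)) (aemit (heads (conf env o (Some b))))
  = conf env (rcons o b) None.
Proof.
apply: functional_extensionality => i; apply: functional_extensionality => z.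
rewrite /update /aemit /heads /tape_update /conf.
case: (i =P 0 :> nat) => [_|_] /=; last by case: eqP => [->|].
rewrite /out_tape /tape_of_word size_rcons.
have onthE (j : nat) : onth (rcons o b) j =
    if j < size o then onth o j else if j == size o then Some b else None.
  rewrite -cats1 onth_cat; case: ltngtP => // [ltoj|->]; last by rewrite subnn.
  by rewrite onth_default //= subn_gt0.
case: (z + 1 =P 0)%R => [z1|z1].
  have -> : z = (-1)%R by lia.
  by rewrite (_ : (-1 + (size o).+1%:Z)%R = size o) ?onthE ?ltnn ?eqxx //; lia.
rewrite (_ : (z + 1 + size o = z + (size o).+1 :> int)%R); last by lia.
case: (z =P 0%R) => [->|z0].
  by rewrite add0r onth_default.
case Ez: (z + _)%R => [j|j] //; rewrite onthE; case: ifP => // ej.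
by rewrite onth_default; [case: eqP => // ej'|]; lia.
Qed.

Lemma shift0 d env : shift d 0 env = env.
Proof.
by apply: functional_extensionality => i; rewrite /shift; case: (d i); rewrite ?subn0 ?addn0.
Qed.

Lemma shiftS d j env : shift d j (shift d 1 env) = shift d j.+1 env.
Proof. by apply: functional_extensionality => i; rewrite /shift; case: (d i) => //; lia. Qed.

(** A round costs one test and one move, whence the factor 2; the failing test is the additional
    step. *)
Lemma sweep_conf (b : syms -> bool) ls rs j env o fl :
  (forall i, i \in ls -> j <= env i) ->
  (forall i, i < j -> b (heads (conf (shift (dir ls rs) i env) o fl))) ->
  ~~ b (heads (conf (shift (dir ls rs) j env) o fl)) ->
  terminates (sweep b ls rs) (conf env o fl) j.*2.+1 (conf (shift (dir ls rs) j env) o fl).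
Proof.
elim: j env => [|j IH] env lj bi bj.
  by rewrite shift0 in bj *; apply: terminates_while_end.
have b0 : b (heads (conf env o fl)) by have := bi 0 isT; rewrite shift0.
have -> : j.+1.*2.+1 = (1 + j.*2.+1).+1 by lia.
apply: terminates_while (terminates_act _ _) _ => //.
rewrite amove_conf => [|i]; last first.
  by rewrite /dir; case: ifP => [/lj ? _|_]; [lia | case: ifP].
rewrite -shiftS in bj *; apply: IH => // i; last by move=> ij; rewrite shiftS; apply: bi; lia.
by move=> il; have := lj i il; rewrite /shift /dir il; lia.
Qed.

Ltac arith := repeat match goal with H : _ <> _ |- _ => clear H end; lia.

Ltac arith_n := repeat match goal with H : _ <> _ |- _ => clear H end; nia.

Ltac env_cases :=
  rewrite /shift /dir /upd ?inE;
  repeat first [progress rewrite ?eqxx /= | match goal with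
  | H : ?a <> ?b |- context [?a == ?b] => rewrite (introF eqP H)
  | H : ?b <> ?a |- context [?a == ?b] => rewrite (eq_sym a b) (introF eqP H)
  | |- context [?a == ?b] => case: (@eqP _ a b); [let E := fresh in intro E; subst a | intro]
  end]; rewrite ?orbF ?orbT /=; try arith.

Ltac env_ext := apply: functional_extensionality; let i := fresh "i" in intro i; env_cases.

Lemma at_zeroN env o fl r : 0 < r <= k ->
  ~~ at_zero r (heads (conf env o fl)) = (0 < env r).
Proof. by move=> rk; rewrite at_zeroE // lt0n. Qed.

Lemma add_code_conf r s t u v env o fl :
  all (fun i => 0 < i <= k) [:: r; s; t; u; v] -> uniq [:: r; s; t; u; v] ->
  (forall i, env i <= N) -> env u = 0 -> env v = 0 ->
  terminates (add_code r s t u v) (conf env o fl) (4 * N.*2.+1 + 1)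
    (conf env o (Some (env r + env s == env t))).
Proof.
rewrite /= !inE => /and5P[rk sk tk uk /andP[vk _]] Hu bnd eu ev.
have {Hu} [[rs rt ru] [rv st su] [sv tu tv] uv] :
  [/\ [/\ r <> s, r <> t & r <> u], [/\ r <> v, s <> t & s <> u],
      [/\ s <> v, t <> u & t <> v] & u <> v] by repeat split; lia.
have := bnd r; have := bnd s; have := bnd t => bt bs br.
(* [j1] and [j2] are the lengths of the two descending sweeps. They and the intermediate
   environments stay opaque behind equations, so that they do not unfold. *)
have [j1 Ej1] : exists j1, j1 = minn (env r) (env t) by eexists.
have [j2 Ej2] : exists j2, j2 = minn (env s) (env t - j1) by eexists.
have [env1 Ee1] : exists e, e = shift (dir [:: r; t] [:: u]) j1 env by eexists.
have [env2 Ee2] : exists e, e = shift (dir [:: s; t] [:: v]) j2 env1 by eexists.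
have [e1r e1s e1t e1u e1v] : [/\ env1 r = env r - j1, env1 s = env s,
    env1 t = env t - j1, env1 u = j1 & env1 v = 0] by split; rewrite Ee1; env_cases.
have [e2r e2s e2t e2u e2v] : [/\ env2 r = env r - j1, env2 s = env s - j2,
    env2 t = env t - j1 - j2, env2 u = j1 & env2 v = j2].
  by split; rewrite Ee2; env_cases.
have E : env = shift (dir [:: u] [:: r; t]) j1 (shift (dir [:: v] [:: s; t]) j2 env2).
  by rewrite Ee2 Ee1; clear Ee1 Ee2; env_ext.
have Eb : (env r + env s == env t) = [&& env2 r == 0, env2 s == 0 & env2 t == 0].
  by rewrite e2r e2s e2t; arith.
rewrite {2}E Eb.
apply: terminates_leq (terminates_seq (sweep_conf (j := j1) _ _ _)
  (terminates_seq (_ : terminates _ _ j2.*2.+1 (conf env2 o fl))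
  (terminates_seq (terminates_act _ _)
  (terminates_seq (_ : terminates _ _ j2.*2.+1 _) (sweep_conf (j := j1) _ _ _))))).
- by arith.
- by move=> i; rewrite !inE => /orP[]/eqP->; arith.
- move=> i ij; rewrite !at_zeroN //.
  have {ij} [ir it] : i < env r /\ i < env t by arith.
  by clear - ir it rt tu ru; env_cases.
- by rewrite !at_zeroN // -Ee1 e1r e1t; arith.
- rewrite -Ee1 Ee2; apply: sweep_conf.
  + by move=> i; rewrite !inE => /orP[]/eqP->; rewrite ?e1s ?e1t; arith.
  + move=> i ij; rewrite !at_zeroN //.
    have {ij} [is' it] : i < env1 s /\ i < env1 t by arith.
    by clear - is' it st sv tv; env_cases.
  + by rewrite !at_zeroN // -Ee2 e2s e2t; arith.
- rewrite aflag_conf !at_zeroE //; apply: sweep_conf; clear Ee1 Ee2 E.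
  + by move=> i; rewrite !inE => /eqP->; rewrite e2v.
  + by move=> i ij; rewrite !at_zeroN //; env_cases.
  + by rewrite !at_zeroN //; env_cases.
- by clear Ee1 Ee2 E; move=> i; rewrite !inE => /eqP->; env_cases.
- by clear Ee1 Ee2 E; move=> i ij; rewrite !at_zeroN //; env_cases.
- by clear Ee1 Ee2 E; rewrite !at_zeroN //; env_cases.
Qed.

(** Even an incomplete last round empties [t] into [v], so the final registers do not depend on the
    answer. A round removes at least one unit from [t], which drives the induction and bounds the
    number of rounds by [T]. *)
Lemma div_loop_conf r t u v T env o :
  all (fun i => 0 < i <= k) [:: r; t; u; v] -> uniq [:: r; t; u; v] ->
  0 < env r <= N -> T <= N -> env t = T -> env u = 0 ->
  terminates (div_loop r t u v) (conf env o (Some true)) (T * (4 * N + 5) + 1)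
    (conf (upd (upd env t 0) v (env v + T)) o (Some (env r %| T))).
Proof.
rewrite /= !inE => /and4P[rk tk uk /andP[vk _]] Hu.
have {Hu} [[rt ru rv] [tu tv uv]] :
  [/\ r <> t, r <> u & r <> v] /\ [/\ t <> u, t <> v & u <> v] by repeat split; lia.
have [n] := ubnP T; elim: n T env => // n IH T env ltTn rN TN et eu.
have [T0|T0] := posnP T.
  have -> : upd (upd env t 0) v (env v + T) = env by env_ext.
  rewrite T0 dvdn0; apply: terminates_while_end.
  rewrite !flagE at_zeroN //; arith.
have [j Ej] : exists j, j = minn (env r) T by eexists.
have [env1 Ee1] : exists e, e = shift (dir [:: r; t] [:: u; v]) j env by eexists.
have [env2 Ee2] : exists e, e = upd (upd env t (T - j)) v (env v + j) by eexists.
have H1 : terminates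
    (Seq (sweep (fun y => ~~ at_zero r y && ~~ at_zero t y) [:: r; t] [:: u; v])
    (Seq (Act (aflag (at_zero r)))
         (sweep (fun y => ~~ at_zero u y) [:: u] [:: r])))
    (conf env o (Some true)) (4 * N + 3) (conf env2 o (Some (env r <= T))).
  have E2 : env2 = shift (dir [:: u] [:: r]) j env1 by rewrite Ee1 Ee2; env_ext.
  have -> : (env r <= T) = (env1 r == 0).
    have -> : env1 r = env r - j by rewrite Ee1; env_cases.
    by arith.
  rewrite E2; have e1u : env1 u = j by rewrite Ee1; env_cases.
  apply: terminates_leq (terminates_seq (_ : terminates _ _ j.*2.+1 (conf env1 o (Some true)))
    (terminates_seq (terminates_act _ _) (_ : terminates _ _ j.*2.+1 _))).
  - by arith.
  - rewrite Ee1; apply: sweep_conf.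
    + by move=> i; rewrite !inE => /orP[]/eqP->; arith.
    + move=> i ij; rewrite !at_zeroN //.
      have {ij} [ir it] : i < env r /\ i < env t by arith.
      by clear - ir it rt tu ru rv tv; env_cases.
    + rewrite !at_zeroN //.
      have -> : shift (dir [:: r; t] [:: u; v]) j env r = env r - j by env_cases.
      have -> : shift (dir [:: r; t] [:: u; v]) j env t = env t - j by env_cases.
      by arith.
  - rewrite aflag_conf !at_zeroE //; apply: sweep_conf.
    + by move=> i; rewrite !inE => /eqP->; rewrite e1u.
    + by move=> i ij; rewrite !at_zeroN //; clear - ij e1u ru; env_cases.
    + by rewrite !at_zeroN //; clear - e1u ru; env_cases.
have b0 : (fun y : syms => ~~ at_zero t y && flag y) (heads (conf env o (Some true))).
  by rewrite /= at_zeroN // flagE; arith.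
have [rT|Tr] := leqP (env r) T.
- rewrite rT in H1; have {}Ej : j = env r by arith.
  have := IH (T - j) env2.
  have -> : env2 r = env r by rewrite Ee2; env_cases.
  have -> : env2 v = env v + j by rewrite Ee2; env_cases.
  have -> : upd (upd env2 t 0) v (env v + j + (T - j)) = upd (upd env t 0) v (env v + T).
    by rewrite Ee2; env_ext.
  have -> : (env r %| T - j) = (env r %| T) by rewrite Ej -{2}(subnK rT) dvdn_addl.
  move=> H2; apply: terminates_leq (terminates_while b0 H1 (H2 _ _ _ _ _)); try arith.
  + arith_n.
  + by rewrite Ee2; env_cases.
  + by rewrite Ee2; env_cases.
- have {}Ej : j = T by arith.
  have -> : env r %| T = false by apply/negP => /dvdn_leq; arith.
  have -> : upd (upd env t 0) v (env v + T) = env2 by rewrite Ee2 Ej; env_ext.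
  rewrite leqNgt Tr /= in H1.
  apply: terminates_leq (terminates_while b0 H1 (terminates_while_end _)); first arith_n.
  by rewrite flagE andbF.
Qed.

Lemma div_code_conf r t u v env o fl :
  all (fun i => 0 < i <= k) [:: r; t; u; v] -> uniq [:: r; t; u; v] ->
  (forall i, env i <= N) -> env u = 0 -> env v = 0 ->
  terminates (div_code r t u v) (conf env o fl) (N * (4 * N + 5) + N.*2 + 3)
    (conf env o (Some (env r %| env t))).
Proof.
move=> Hk Hu bnd eu ev; have [br bt] := (bnd r, bnd t).
have [rk tk uk vk] : [/\ 0 < r <= k, 0 < t <= k, 0 < u <= k & 0 < v <= k].
  by move: Hk => /= /and5P[].
have [rt tv tu] : [/\ r <> t, t <> v & t <> u].
  by move: Hu; rewrite /= !inE; split; lia.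
pose c := (env r > 0) || (env t == 0).
have H0 : terminates (Act (aflag (fun y => ~~ at_zero r y || at_zero t y)))
    (conf env o fl) 1 (conf env o (Some c)).
  have := terminates_act (aflag (fun y => ~~ at_zero r y || at_zero t y)) (conf env o fl).
  by rewrite aflag_conf at_zeroN // at_zeroE.
(* [T] is the amount that the loop moves from [t] to [v]: none at all when r = 0, since the loop is
   then skipped. *)
have [T ET] : exists T, T = if env r > 0 then env t else 0 by eexists.
have [env1 Ee1] : exists e, e = upd (upd env t (env t - T)) v T by eexists.
have H1 : terminates (div_loop r t u v) (conf env o (Some c)) (N * (4 * N + 5) + 1)
    (conf env1 o (Some (env r %| env t))).
  rewrite Ee1 ET /c; case: posnP => r0 /=.
    have -> : upd (upd env t (env t - 0)) v 0 = env by env_ext.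
    have -> : (env r %| env t) = (env t == 0) by rewrite r0 dvd0n.
    apply: terminates_leq (terminates_while_end _); first arith_n.
    by rewrite flagE at_zeroN //; arith.
  have := @div_loop_conf r t u v (env t) env o Hk Hu.
  rewrite ev subnn add0n => H2; apply: terminates_leq (H2 _ _ _ _) => //; [arith_n|arith].
have -> : N * (4 * N + 5) + N.*2 + 3 = 1 + ((N * (4 * N + 5) + 1) + N.*2.+1) by arith.
apply: terminates_seq H0 (terminates_seq H1 _).
move: (Some (env r %| env t)) => fl'.
have -> : env = shift (dir [:: v] [:: t]) T env1.
  by rewrite Ee1 ET; case: ifP => _; env_ext.
have e1v : env1 v = T by rewrite Ee1; env_cases.
have TN : T <= N by rewrite ET; case: ifP.
apply: terminates_leq (sweep_conf _ _ _); first by arith.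
- by move=> i; rewrite !inE => /eqP->; rewrite e1v.
- by move=> i ij; rewrite !at_zeroN //; clear - ij e1v tv; env_cases.
- by rewrite !at_zeroN //; clear - e1v tv; env_cases.
Qed.

Fixpoint fm_cost (n : nat) (f : fm) : nat :=
  match f with
  | FIn _ _ | FZero _ => 1
  | FAdd _ _ _ => 4 * n.*2.+1 + 1
  | FDiv _ _ => n * (4 * n + 5) + n.*2 + 3
  | FNot f => fm_cost n f + 1
  | FAnd f g => fm_cost n f + (fm_cost n g).+2
  | FEx _ f => fm_cost n f + ((n * (fm_cost n f).+2).+1 + n.*2.+1)
  end.

Fixpoint gen_cost (n : nat) (g : gen) : nat :=
  match g with
  | GEmit _ => 2
  | GBit f => fm_cost n f + 1
  | GSeq g h => gen_cost n g + gen_cost n h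
  | GFor _ f g =>
      let c := fm_cost n f + (gen_cost n g).+2 in
      c + ((n * c.+2).+1 + n.*2.+1)
  end.

Lemma fresh_upd d env x : (forall i, d <= i -> env i = 0) ->
  forall i, d.+1 <= i -> upd env d x i = 0.
Proof.
by move=> fr i di; rewrite /upd; case: eqP => [Ei|_]; [lia | apply: fr; lia].
Qed.

Lemma bounded_upd d env x : (forall i, env i <= N) -> x <= N ->
  forall i, upd env d x i <= N.
Proof. by move=> bnd xN i; rewrite /upd; case: eqP. Qed.

Lemma rewind_conf r x env o fl : 0 < r <= k -> env r = 0 -> x <= N ->
  terminates (sweep (fun y => ~~ at_zero r y) [:: r] [::])
    (conf (upd env r x) o fl) N.*2.+1 (conf env o fl).
Proof.
move=> rk er xN.
have {2}-> : env = shift (dir [:: r] [::]) x (upd env r x) by env_ext.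
apply: terminates_leq (sweep_conf _ _ _); first by lia.
- by move=> i; rewrite inE => /eqP->; rewrite upd_eq.
- by move=> i ij; rewrite at_zeroN //; env_cases.
- by rewrite at_zeroN //; env_cases.
Qed.

Lemma inc_conf r x env o fl :
  update (conf (upd env r x) o fl)
    (amove (dir [::] [:: r]) (heads (conf (upd env r x) o fl))) =
  conf (upd env r x.+1) o fl.
Proof.
rewrite amove_conf => [|i]; last by rewrite /dir /=; case: ifP.
by congr conf; env_ext.
Qed.

Lemma fm_code_conf f d env o fl :
  wf_fm k d f -> (forall i, d <= i -> env i = 0) -> (forall i, env i <= N) ->
  terminates (fm_code d f) (conf env o fl) (fm_cost N f)
    (conf env o (Some (sat w env f))).
Proof.
elim: f d env o fl => [b r|r|r s t|r t|f IH|f IHf g IHg|r f IH] d env o fl /=.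
- move=> /andP[rd dk] fr bnd.
  have rk : 0 < r <= k by lia.
  have := terminates_act (aflag (at_bit b r)) (conf env o fl).
  by rewrite aflag_conf at_bitE.
- move=> /andP[rd dk] fr bnd.
  have rk : 0 < r <= k by lia.
  have := terminates_act (aflag (at_zero r)) (conf env o fl).
  by rewrite aflag_conf at_zeroE.
- rewrite !inE => H fr bnd; apply: add_code_conf => //=; rewrite ?inE ?fr //; lia.
- move=> H fr bnd; apply: div_code_conf => //=; rewrite ?inE ?fr //; lia.
- move=> wff fr bnd; apply: terminates_seq (IH _ _ _ _ wff fr bnd) _.
  set b := sat _ _ _.
  have := terminates_act (aflag (fun y => ~~ flag y)) (conf env o (Some b)).
  by rewrite aflag_conf flagE.
- case/andP=> wff wfg fr bnd; apply: terminates_seq (IHf _ _ _ _ wff fr bnd) _.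
  apply: terminates_if; rewrite flagE; case: (sat w env f) => /=.
    by apply: terminates_leq (IHg _ _ _ _ wfg fr bnd); lia.
  apply: (@terminates_leq _ _ _ 1); first by lia.
  by have := terminates_act noop (conf env o (Some false)); rewrite update_noop.
- case/and4P=> /eqP-> d0 dk wff fr bnd; set C := fm_cost N f.
  have rk : 0 < d <= k by lia.
  have ed : env d = 0 by apply: fr.
  have body x o' fl' : x <= N -> terminates (fm_code d.+1 f) (conf (upd env d x) o' fl') C
      (conf (upd env d x) o' (Some (sat w (upd env d x) f))).
    by move=> xN; apply: IH => //; [apply: fresh_upd | apply: bounded_upd].
  (* The search stops at the first witness, so the final content [y] of the register is only known
     to be in range; the rewinding erases it. The bit [b] tells whether the value just tried is a
     witness. *)
  have loop j x b : x + j = N -> exists2 y, y <= N &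
      terminates (While (fun y => ~~ flag y && ~~ at_end d y)
             (Seq (Act (amove (dir [::] [:: d]))) (fm_code d.+1 f)))
        (conf (upd env d x) o (Some b)) (j * C.+2).+1
        (conf (upd env d y) o
          (Some (b || has (fun x => sat w (upd env d x) f) (iota x.+1 j)))).
    elim: j x b => [|j IHj] x b xj.
      exists x; first by lia.
      rewrite orbF; apply: terminates_while_end.
      by rewrite at_endE // upd_eq flagE; lia.
    case: b; first exists x; first by lia.
      rewrite orTb; apply: terminates_leq (terminates_while_end _); first by lia.
      by rewrite flagE.
    have [y yN Hy] := IHj x.+1 (sat w (upd env d x.+1) f) ltac:(lia).
    exists y => //.
    have -> : (j.+1 * C.+2).+1 = ((1 + C) + (j * C.+2).+1).+1 by lia.
    apply: terminates_while Hy.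
      by rewrite flagE at_endE // upd_eq; lia.
    apply: terminates_seq (terminates_act _ _) _.
    by rewrite inc_conf; apply: body; lia.
  have [y yN Hy] := loop N 0 (sat w (upd env d 0) f) erefl.
  apply: terminates_seq (terminates_seq Hy (rewind_conf _ _ rk ed yN)).
  by rewrite -{1}(upd_id ed); apply: body.
Qed.

(** The flag left behind is unspecified: every later test or emission sets it before it is read. *)
Lemma gen_code_conf g d env o fl :
  wf_gen k d g -> (forall i, d <= i -> env i = 0) -> (forall i, env i <= N) ->
  exists fl', terminates (gen_code d g) (conf env o fl) (gen_cost N g)
    (conf env (o ++ out w env g) fl').
Proof.
elim: g d env o fl => [b|f|g IHg h IHh|r f g IHg] d env o fl /=.
- move=> _ fr bnd; exists None; apply: terminates_seq (terminates_act _ _) _.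
  by rewrite aflag_conf cats1 -aemit_conf; apply: terminates_act.
- move=> wff fr bnd; exists None; apply: terminates_seq (fm_code_conf _ _ wff fr bnd) _.
  by rewrite cats1 -aemit_conf; apply: terminates_act.
- case/andP=> wfg wfh fr bnd.
  have [fl1 H1] := IHg d env o fl wfg fr bnd.
  have [fl2 H2] := IHh d env (o ++ out w env g) fl1 wfh fr bnd.
  by exists fl2; rewrite catA; apply: terminates_seq H2.
- case/and5P=> /eqP-> d0 dk wff wfg fr bnd.
  set C := fm_cost N f + (gen_cost N g).+2.
  set body := Seq (fm_code d.+1 f) _.
  pose F x := if sat w (upd env d x) f then out w (upd env d x) g else [::].
  have rk : 0 < d <= k by lia.
  have ed : env d = 0 by apply: fr.
  have bodyP x o' fl' : x <= N -> exists fl'',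
      terminates body (conf (upd env d x) o' fl') C (conf (upd env d x) (o' ++ F x) fl'').
    move=> xN; have fr' := fresh_upd x fr.
    have bnd' : forall i, upd env d x i <= N by apply: bounded_upd.
    have H1 := fm_code_conf o' fl' wff fr' bnd'.
    have [fl2 H2] := IHg _ _ o' (Some true) wfg fr' bnd'.
    exists (if sat w (upd env d x) f then fl2 else Some false).
    apply: terminates_seq H1 _; apply: terminates_if; rewrite flagE /F.
    case: (sat w _ f); first by apply: terminates_leq H2; lia.
    apply: (@terminates_leq _ _ _ 1); first by lia.
    rewrite cats0.
    by have := terminates_act noop (conf (upd env d x) o' (Some false)); rewrite update_noop.
  have loop j x o' fl' : x + j = N -> exists fl'',
      terminates (While (fun y => ~~ at_end d y)
             (Seq (Act (amove (dir [::] [:: d]))) body))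
        (conf (upd env d x) o' fl') (j * C.+2).+1
        (conf (upd env d N) (o' ++ flatten [seq F y | y <- iota x.+1 j]) fl'').
    elim: j x o' fl' => [|j IHj] x o' fl' xj.
      exists fl'; rewrite cats0 -xj addn0; apply: terminates_while_end.
      by rewrite at_endE // upd_eq; lia.
    have [fl2 H2] := bodyP x.+1 o' fl' ltac:(lia).
    have [fl3 H3] := IHj x.+1 (o' ++ F x.+1) fl2 ltac:(lia).
    exists fl3.
    have -> : (j.+1 * C.+2).+1 = ((1 + C) + (j * C.+2).+1).+1 by lia.
    rewrite /= catA; apply: terminates_while H3.
      by rewrite at_endE // upd_eq; lia.
    by apply: terminates_seq (terminates_act _ _) _; rewrite inc_conf.
  have [fl1 H1] := bodyP 0 o fl isT.
  have [fl2 H2] := loop N 0 (o ++ F 0) fl1 erefl.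
  exists fl2; rewrite -{1}(upd_id ed) catA.
  exact: terminates_seq H1 (terminates_seq H2 (rewind_conf _ _ rk ed (leqnn N))).
Qed.

(** * Distributing the input to the registers and rewinding the output *)

Definition asetup (mark : bool) (s : syms) : acts :=
  fun i => (if i == 0 :> nat then None else
            if s ord0 is Some (inl b) then Some (if mark then inr b else inl b) else None,
            MoveR).

Definition nonblank (s : syms) : bool := if s ord0 is None then false else true.

(** The input moves from tape 0 to all other tapes at once, which also clears tape 0 for the output.
    The heads of the copies stay aligned on the way back, so testing tape 1 is enough. *)
Definition setup_code : cmd :=
  Seq (Act (asetup true))
 (Seq (While nonblank (Act (asetup false)))
      (sweep (fun y => ~~ at_zero 1 y) (iota 1 k) [::])).

Definition aclear (s : syms) : acts :=
  fun i => if i == 0 :> nat then (None, MoveL) else (s i, MoveN).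
Definition aback (m : move) (s : syms) : acts :=
  fun i => (s i, if i == 0 :> nat then m else MoveN).

Definition finish_code : cmd :=
  Seq (Act aclear) (Seq (While nonblank (Act (aback MoveL))) (Act (aback MoveR))).

Definition program (g : gen) : cmd := Seq setup_code (Seq (gen_code 1 g) finish_code).

(** The invariant of the copying loop: [u] has been copied, with the heads standing behind it, and
    tape 0 retains [v]. *)
Definition half_copied (u v : seq bool) : tapes k :=
  fun i => if i == 0 :> nat then tape_of_word bool v
           else fun z => cell u (z + (size u)%:Z)%R.

Lemma ord0_val (i : 'I_k.+1) : (i == 0 :> nat) = (i == ord0).
Proof. by []. Qed.

Lemma asetup_conf u b v :
  update (half_copied u (b :: v)) (asetup (u == [::]) (heads (half_copied u (b :: v))))
  = half_copied (rcons u b) v.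
Proof.
apply: functional_extensionality => i; apply: functional_extensionality => z.
rewrite /update /asetup /heads /tape_update /half_copied /=; case: (i =P 0 :> nat) => _.
  case: (z + 1 =P 0)%R => [z1|z1]; first by have -> : z = (-1)%R by lia.
  case: z z1 => [j|j] z1; first by rewrite (_ : (j%:Z + 1)%R = j.+1) //; lia.
  by case: j z1 => // j _; rewrite (_ : (Negz j.+1 + 1)%R = Negz j) //; lia.
rewrite size_rcons /cell; case: (z + 1 =P 0)%R => [z1|z1].
  have -> : (z + (size u).+1 = size u)%R by lia.
  rewrite -cats1 onth_cat ltnn subnn /=.
  by case: u.
have -> : (z + 1 + size u = z + (size u).+1 :> int)%R by lia.
case Ez: (z + _)%R => [j|] //.
rewrite -cats1 onth_cat; case: ltnP => // uj.
rewrite (onth_default uj); have : 0 < j - size u by lia.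
by case: (j - size u) => // i1 _; rewrite /= onth0n.
Qed.

Lemma setup_code_conf : 0 < k ->
  terminates setup_code (half_copied [::] w) (N * 4 + 3) (conf (fun=> 0) [::] None).
Proof.
move=> k0.
have loop u v : u != [::] -> u ++ v = w ->
    terminates (While nonblank (Act (asetup false))) (half_copied u v) (2 * size v).+1
      (half_copied w [::]).
  elim: v u => [|b v IH] u u0 Ew.
    by rewrite cats0 in Ew; rewrite Ew; apply: terminates_while_end.
  have -> : (2 * size (b :: v)).+1 = (1 + (2 * size v).+1).+1 by rewrite /=; lia.
  apply: terminates_while (terminates_act _ _) _; first by [].
  have := asetup_conf u b v; rewrite (negbTE u0) => ->.
  by apply: IH; [case: (u) | rewrite cat_rcons].
have [b [v Ew]] : exists b v, w = b :: v by case: (w) w_gt0 => // b v _; exists b, v.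
have H1 : terminates (Act (asetup true)) (half_copied [::] w) 1 (half_copied [:: b] v).
  have := terminates_act (asetup true) (half_copied [::] w).
  by rewrite [X in update (half_copied _ X) _]Ew [X in heads (half_copied _ X)]Ew
             (asetup_conf [::]).
have H2 := loop [:: b] v isT (esym Ew).
have H3 : terminates (sweep (fun y => ~~ at_zero 1 y) (iota 1 k) [::])
    (half_copied w [::]) N.*2.+1 (conf (fun=> 0) [::] None).
  have -> : half_copied w [::] = conf (fun=> N) [::] None.
    apply: functional_extensionality => i; apply: functional_extensionality => z.
    rewrite /half_copied /conf /ruler /out_tape; case: (i =P 0 :> nat) => // _.
    by case: z => [[|j]|j] //=; rewrite ?addr0 ?onth_default.
  have -> : conf (fun=> 0) [::] None = conf (shift (dir (iota 1 k) [::]) N (fun=> N)) [::] None.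
    apply: functional_extensionality => i; rewrite /conf; case: (i =P 0 :> nat) => // i0.
    congr ruler; rewrite /shift /dir mem_iota.
    by rewrite ifT ?subnn //; have := ltn_ord i; lia.
  have m1 : 1 \in iota 1 k by rewrite mem_iota; lia.
  apply: sweep_conf => // [i iN|]; rewrite at_zeroN ?k0 //.
    by rewrite /shift /dir m1 /=; lia.
  by rewrite /shift /dir m1 /= subnn.
apply: terminates_leq (terminates_seq H1 (terminates_seq H2 H3)).
by rewrite Ew /=; lia.
Qed.

(** An output word is read from the head up to a blank. Hence the flag cell is erased and the head
    returns, stopped by the blank to the left of the word. *)
Lemma finish_code_out T o fl : T ord0 = out_tape o fl ->
  exists2 T', terminates finish_code T (2 * size o + 3) T' &
              T' ord0 = tape_of_word bool o.
Proof.
move=> ET.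
have loop j T1 : j <= size o -> T1 ord0 = (fun z => tape_of_word bool o (z + j%:Z - 1)%R) ->
    exists2 T2, terminates (While nonblank (Act (aback MoveL))) T1 (2 * j).+1 T2 &
                T2 ord0 = (fun z => tape_of_word bool o (z - 1)%R).
  elim: j T1 => [|j IH] T1 jo ET1.
    exists T1; last by rewrite ET1; apply: functional_extensionality => z; rewrite addr0.
    by apply: terminates_while_end; rewrite /nonblank /heads ET1.
  pose T2 := update T1 (aback MoveL (heads T1)).
  have ET2 : T2 ord0 = (fun z => tape_of_word bool o (z + j%:Z - 1)%R).
    apply: functional_extensionality => z; rewrite /T2 /update /aback /heads /tape_update /=.
    case: (z - 1 =P 0)%R => [z1|_]; rewrite ET1; congr (tape_of_word _ _ _); lia.
  have [T3 H3 ET3] := IH _ (ltnW jo) ET2.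
  exists T3 => //; have -> : (2 * j.+1).+1 = (1 + (2 * j).+1).+1 by lia.
  apply: terminates_while (terminates_act _ _) H3.
  rewrite /nonblank /heads ET1 (_ : (0 + j.+1%:Z - 1)%R = j); last by lia.
  by rewrite /tape_of_word; have := onthTE o j; rewrite jo; case: (onth o j).
pose T1 := update T (aclear (heads T)).
have [|T2 H2 ET2] := loop (size o) T1 (leqnn _).
  apply: functional_extensionality => z; rewrite /T1 /update /aclear /heads /tape_update /=.
  rewrite ET /out_tape; case: (z - 1 =P 0)%R => [z1|z1].
    by rewrite (_ : (z + size o - 1)%R = size o) /= ?onth_default //; lia.
  by congr (tape_of_word _ _ _); lia.
exists (update T2 (aback MoveR (heads T2))).
  have -> : 2 * size o + 3 = 1 + ((2 * size o).+1 + 1) by lia.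
  exact: terminates_seq (terminates_act _ _) (terminates_seq H2 (terminates_act _ _)).
apply: functional_extensionality => z; rewrite /update /aback /heads /tape_update /=.
case: (z + 1 =P 0)%R => [z1|z1]; rewrite ET2; congr (tape_of_word _ _ _); lia.
Qed.

(** Each letter costs a step; this bounds the time for rewinding the output. *)
Lemma size_out env g : size (out w env g) <= gen_cost N g.
Proof.
elim: g env => [b|f|g IHg h IHh|r f g IHg] env //.
- by rewrite /= addn1.
- by rewrite /= size_cat leq_add.
pose G := gen_cost N g; pose C := fm_cost N f + G.+2.
rewrite [gen_cost _ _]/(C + ((N * C.+2).+1 + N.*2.+1)) [out _ _ _]/(flatten _).
set s := iota _ _; apply: (@leq_trans (size s * gen_cost N g)); last first.
  rewrite /s size_iota mulSn -/G.
  have : N * G <= N * C.+2 by rewrite leq_mul2l /C; lia.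
  by rewrite /C; lia.
elim: s => //= x s IH; rewrite size_cat mulSn leq_add //.
by case: ifP => // _; apply: IHg.
Qed.

Lemma program_run g : 0 < k -> wf_gen k 1 g ->
  exists2 c, tm_run (N * 4 + 3 + (gen_cost N g + (2 * gen_cost N g + 3)))
               (tm_init (machine (program g)) w) = Some c
           & tm_output c (out w (fun=> 0) g).
Proof.
move=> k0 wfg; have H1 := setup_code_conf k0.
have [fl H2] := @gen_code_conf g 1 (fun=> 0) [::] None wfg (fun=> fun=> erefl) (fun=> leq0n _).
rewrite cat0s in H2; set o := out w _ g in H2 *.
have [T3 H3 ET3] := @finish_code_out (conf (fun=> 0) o fl) o fl erefl.
exists ((None, T3) : config (machine (program g))); last first.
  by move=> i _; rewrite /= ET3.
have -> : tm_init (machine (program g)) w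
    = (Some (start_of _ (program g)), half_copied [::] w) :> config (machine (program g)).
  congr pair; apply: functional_extensionality => i; rewrite /half_copied ord0_val.
  case: eqP => // _; apply: functional_extensionality => z.
  by rewrite /cell /tape_of_word addr0; case: z => // j; rewrite !onth_default.
apply: machine_run; apply: terminates_leq (terminates_seq H1 (terminates_seq H2 H3)).
by have := size_out (fun=> 0) g; rewrite -/o; lia.
Qed.

End Correctness.
End Registers.

(** * Polynomial time bounds *)

Definition poly_bounded (f : nat -> nat) : Prop :=
  exists p : {poly nat}, forall n, f n <= p.[n]%R.

Lemma poly_bounded_leq f g : (forall n, f n <= g n) -> poly_bounded g -> poly_bounded f.
Proof. by move=> fg [p gp]; exists p => n; apply: leq_trans (gp n). Qed.

Lemma poly_bounded_const c : poly_bounded (fun=> c).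
Proof. by exists c%:P%R => n; rewrite hornerC. Qed.

Lemma poly_bounded_id : poly_bounded (fun n => n).
Proof. by exists 'X%R => n; rewrite hornerX. Qed.

Lemma poly_boundedD f g : poly_bounded f -> poly_bounded g ->
  poly_bounded (fun n => f n + g n).
Proof. by move=> [p fp] [q gq]; exists (p + q)%R => n; rewrite hornerD leq_add. Qed.

Lemma poly_boundedM f g : poly_bounded f -> poly_bounded g ->
  poly_bounded (fun n => f n * g n).
Proof. by move=> [p fp] [q gq]; exists (p * q)%R => n; rewrite hornerM leq_mul. Qed.

Ltac poly_bound := repeat first
  [ assumption | apply: poly_bounded_id | apply: poly_boundedD | apply: poly_boundedM
  | apply: poly_bounded_const ].

Lemma fm_cost_poly f : poly_bounded (fm_cost^~ f).
Proof.
elim: f => [b r|r|r s t|r t|f IH|f IHf g IHg|r f IH] /=; try by poly_bound.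
- by apply: (@poly_bounded_leq _ (fun n => 4 * (2 * n + 1) + 1)) => [n|]; [lia|poly_bound].
- apply: (@poly_bounded_leq _ (fun n => n * (4 * n + 5) + 2 * n + 3)) => [n|]; last by poly_bound.
  by lia.
- apply: (@poly_bounded_leq _ (fun n => fm_cost n f + (fm_cost n g + 2))) => [n|].
    by lia.
  by poly_bound.
- apply: (@poly_bounded_leq _
    (fun n => fm_cost n f + (n * (fm_cost n f + 2) + 1 + (2 * n + 1)))) => [n|].
    by nia.
  by poly_bound.
Qed.

Lemma gen_cost_poly g : poly_bounded (gen_cost^~ g).
Proof.
elim: g => [b|f|g IHg h IHh|r f g IHg] /=; try by poly_bound.
  by have := fm_cost_poly f => H; poly_bound.
have Hf := fm_cost_poly f; pose c n := fm_cost n f + (gen_cost n g + 2).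
apply: (@poly_bounded_leq _ (fun n => c n + (n * (c n + 2) + 1 + (2 * n + 1)))) => [n|].
  by rewrite /c; nia.
by rewrite /c; poly_bound.
Qed.

(** The link to the machine model: the generator and the number [k] of registers are fixed, so a
    single machine serves all inputs, and polynomial time reduces to an identity between words. *)
Lemma polytime_gen (A B : Type) (eA : A -> seq bool) (eB : B -> seq bool)
    (D : A -> Prop) (F : A -> B) (k : nat) (g : gen) :
  wf_gen k 1 g -> 0 < k ->
  (forall x, D x -> 0 < size (eA x)) ->
  (forall x, D x -> out (eA x) (fun=> 0) g = eB (F x)) ->
  polytime_on eA eB D F.
Proof.
move=> wfg k0 szA outE; exists (machine (program k g)).
have [p Hp] : poly_bounded (fun n => n * 4 + 3 + (gen_cost n g + (2 * gen_cost n g + 3))).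
  by have := gen_cost_poly g => H; poly_bound.
exists p => x Dx; rewrite -outE //.
have [c Hc oc] := program_run (szA x Dx) k0 wfg.
exists c => //; rewrite -Hc; move: (Hp (size (eA x))); set n1 := _ + _; set n2 := p.[_]%R.
have H : forall (M : tm) n n' c0 (c1 : config M), n <= n' -> tm_run n c0 = Some c1 ->
    tm_run n' c0 = Some c1.
  move=> M; elim=> [|n IH] [|n'] c0 c1 //=; case: (tm_step c0) => // c2.
  by move=> le_n; apply: IH.
by move=> le_n; rewrite Hc; apply: H Hc.
Qed.

(** * Three-level votes with isolated candidates *)

Record level_vote := LevelVote { tops : pred nat; bots : pred nat; isos : pred nat }.

Definition level (v : level_vote) (x : nat) : nat :=
  if tops v x then 0 else if bots v x then 2 else 1.

Section Votes.
Variable m : nat.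

Definition level_rel (v : level_vote) : rel 'I_m :=
  fun x y => [&& ~~ isos v x, ~~ isos v y & level v x < level v y].

Lemma level_rel_trans v : transitive (level_rel v).
Proof. by move=> y x z /and3P[ix _ xy] /and3P[_ iz yz]; rewrite /level_rel ix iz; lia. Qed.

Lemma level_rel_antisym v : antisymmetric (level_rel v).
Proof. by move=> x y /andP[/and3P[_ _ xy] /and3P[_ _ yx]]; lia. Qed.

Definition vote_of v : partial_vote m :=
  PartialVote (@level_rel_trans v) (@level_rel_antisym v).

Definition proper_vote (v : level_vote) : Prop :=
  [/\ forall x, ~~ (tops v x && bots v x),
      exists2 t : 'I_m, tops v t & ~~ isos v t
    & exists2 b : 'I_m, bots v b & ~~ isos v b].

(* The pair of the first and the last candidate of some linear extension. *)
Definition outcome (v : level_vote) (o : nat * nat) : bool :=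
  [&& o.1 < m, o.2 < m, o.1 != o.2, tops v o.1 || isos v o.1 & bots v o.2 || isos v o.2].

Definition realizes (L : rel 'I_m) (o : nat * nat) : Prop :=
  forall x : 'I_m, (position L x == 0) = (x == o.1 :> nat)
                /\ (position L x == m.-1) = (x == o.2 :> nat).

Lemma position_eq0 (L : rel 'I_m) x : linear_order L ->
  reflect (forall y, L x y) (position L x == 0).
Proof.
case=> Lr La _ Lt; apply: (iffP idP) => [|Lx].
  rewrite cards_eq0 => /eqP E y; have [->|nyx] := eqVneq y x; first exact: Lr.
  have := in_set0 y; rewrite -E inE nyx /= => /negbT nL.
  by have := Lt x y; rewrite (negbTE nL) orbF.
rewrite cards_eq0 -subset0; apply/subsetP => y; rewrite inE => /andP[nyx Lyx].
by case/eqP: nyx; apply: La; rewrite Lyx Lx.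
Qed.

Lemma position_eq_max (L : rel 'I_m) x : linear_order L ->
  reflect (forall y, L y x) (position L x == m.-1).
Proof.
case=> Lr La _ Lt.
have sub : [set y | (y != x) && L y x] \subset [set~ x].
  by apply/subsetP => y; rewrite !inE => /andP[].
have card : #|[set~ x]| = m.-1 by rewrite cardsC1 card_ord.
apply: (iffP idP) => [|Lx].
  rewrite /position -card => /eqP E y; have [->|nyx] := eqVneq y x; first exact: Lr.
  have /eqP Es : [set y | (y != x) && L y x] == [set~ x] by rewrite eqEcard sub E leqnn.
  have : y \in [set~ x] by rewrite !inE.
  by rewrite -Es inE => /andP[].
rewrite /position -card; apply/eqP; congr (#|pred_of_set _|).
by apply/setP => y; rewrite !inE Lx andbT.
Qed.

Lemma position_lt (L : rel 'I_m) x : position L x < m.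
Proof.
rewrite /position -[X in _ < X]card_ord -cardsT; apply: proper_card.
by apply/properP; split; [apply: subsetT | exists x; rewrite !inE ?eqxx].
Qed.

Lemma linear_order_min (L : rel 'I_m) : 0 < m -> linear_order L -> exists x, forall y, L x y.
Proof.
move=> m0 [Lr La Ltr Lt].
have H (s : seq 'I_m) : s != [::] -> exists x, forall y, y \in s -> L x y.
  elim: s => // z s IH _; have [s0|/IH [x Hx]] := eqVneq s [::].
    by exists z => y; rewrite s0 !inE => /eqP->.
  case/orP: (Lt x z) => H; [exists x|exists z] => y; rewrite inE => /predU1P[->|/Hx] //.
  exact: Ltr.
have [|x Hx] := H (enum 'I_m); last by exists x => y; apply: Hx; rewrite mem_enum.
by rewrite -size_eq0 size_enum_ord -lt0n.
Qed.

Lemma linear_order_rev (L : rel 'I_m) : linear_order L -> linear_order (fun x y => L y x).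
Proof.
case=> Lr La Ltr Lt; split=> [x|x y /andP[h1 h2]|y x z h1 h2|x y].
- exact: Lr.
- by apply: La; rewrite h1 h2.
- exact: Ltr h1.
- exact: Lt.
Qed.

(** A non-isolated candidate outside the top level lies below the witness in [tops], so it cannot be
    first; dually for the last candidate and the witness in [bots]. *)
Lemma linear_extension_outcome v L : 1 < m -> proper_vote v ->
  linear_extension (vote_of v) L -> exists2 o, outcome v o & realizes L o.
Proof.
move=> m1 [dis [t tt it] [b bb ib]] [lin ext].
have [u Hu] := linear_order_min (ltnW m1) lin.
have [z Hz] := linear_order_min (ltnW m1) (linear_order_rev lin).
have [Lr La Ltr Lt] := lin.
have uP x : (forall y, L x y) -> x = u by move=> Hx; apply: La; rewrite Hx Hu.
have zP x : (forall y, L y x) -> x = z by move=> Hx; apply: La; rewrite Hx Hz.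
have nuz : u != z.
  apply/negP => /eqP E.
  have all_u x : x = u by apply: La; rewrite E Hz -E Hu.
  have := card_ord m; rewrite -cardsT (_ : [set: 'I_m] = [set u]) ?cards1; first by lia.
  by apply/setP => x; rewrite !inE (all_u x) eqxx.
have lev (x y : 'I_m) : ~~ isos v x -> ~~ isos v y -> level v x < level v y -> L x y.
  by move=> ix iy xy; apply: ext; rewrite /= /level_rel ix iy.
exists (nat_of_ord u, nat_of_ord z).
  rewrite /outcome /= !ltn_ord nuz /=; apply/andP; split.
  - case iu: (isos v u); rewrite ?orbT // orbF; case tu: (tops v u) => //.
    have Ltu : L t u by apply: lev; rewrite ?iu // /level tt tu; case: ifP.
    have E : u = t by apply: La; rewrite Hu Ltu.
    by rewrite E tt in tu.
  - case iz: (isos v z); rewrite ?orbT // orbF; case bz: (bots v z) => //.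
    have tb : tops v b = false by have := dis b; rewrite bb andbT; apply: negbTE.
    have Lzb : L z b by apply: lev; rewrite ?iz // /level bb bz tb; case: ifP.
    have E : z = b by apply: La; rewrite Hz Lzb.
    by rewrite E bb in bz.
move=> x; split.
- apply/(position_eq0 _ lin)/eqP => [/uP->//|/val_inj ->]; exact: Hu.
- apply/(position_eq_max _ lin)/eqP => [/zP->//|/val_inj ->]; exact: Hz.
Qed.

(** Sorting by level and moving the two prescribed candidates to the ends violates no comparison,
    since each of them is isolated or already in the extreme level. *)
Lemma outcome_linear_extension v o : proper_vote v -> outcome v o ->
  exists2 L, linear_extension (vote_of v) L & realizes L o.
Proof.
case: o => u z [dis _ _] /and5P[/= um zm nuz tu bz].
(* Levels shifted by one occupy 1 to 3, which leaves 0 and 4 for the two ends; the summand [x < m]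
   of [code] breaks ties. *)
pose key x := if x == u then 0 else if x == z then 4 else (level v x).+1.
pose code x := key x * m + x.
pose L : rel 'I_m := fun x y => code x <= code y.
have code_inj (x y : 'I_m) : code x = code y -> x = y.
  move=> E; apply: val_inj; have := congr1 (modn^~ m) E.
  by rewrite /code !modnMDl !modn_small.
have lt_code (x y : 'I_m) : key x < key y -> code x < code y.
  move=> lt; rewrite /code; have := ltn_ord x.
  have : (key x).+1 * m <= key y * m by rewrite leq_mul2r lt orbT.
  by rewrite mulSn; lia.
have lin : linear_order L.
  split=> [x|x y|y x w|x y]; rewrite /L //; [|exact: leq_trans|exact: leq_total].
  by move=> h; apply: code_inj; lia.
have key_u x : (x == u) = (key x == 0) by rewrite /key; case: (x == u); case: (x == z).
have key_z x : (x == z) = (key x == 4).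
  rewrite /key; have [->|xu] := eqVneq x u; first by rewrite (negbTE nuz).
  by case: (x == z) => //; rewrite /level; case: ifP => // _; case: ifP.
have key4 x : key x <= 4.
  by rewrite /key; case: ifP => // _; case: ifP => // _; rewrite /level; do 2?case: ifP.
exists L.
  split=> // x y /and3P[ix iy xy]; apply/ltnW/lt_code; rewrite /key.
  have -> : (y == u :> nat) = false.
    apply/eqP => E; move: tu; rewrite -E (negbTE iy) orbF => ty.
    by rewrite {2}/level ty ltn0 in xy.
  have -> : (x == z :> nat) = false.
    apply/eqP => E; move: bz; rewrite -E (negbTE ix) orbF => bx.
    have tx : tops v x = false by have := dis x; rewrite bx andbT; apply: negbTE.
    by move: xy; rewrite {1}/level bx tx /level; case: ifP => // _; case: ifP.
  case: eqP => _; case: eqP => _ //.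
  by rewrite /level; do 2?case: ifP.
move=> x; split.
- apply/(position_eq0 _ lin)/eqP => [/(_ (Ordinal um))|/= E y].
    rewrite /L => le; apply/eqP; rewrite key_u; apply: contraTT le => k0.
    by rewrite -ltnNge; apply: lt_code; rewrite /= {1}/key eqxx lt0n.
  rewrite /L; have [->|nyx] := eqVneq y x; first exact: leqnn.
  apply/ltnW/lt_code; rewrite {1}/key E eqxx lt0n -key_u -E.
  by apply: contraNneq nyx => /val_inj->.
- apply/(position_eq_max _ lin)/eqP => [/(_ (Ordinal zm))|/= E y].
    rewrite /L => le; apply/eqP; rewrite key_z; apply: contraTT le => k0.
    rewrite -ltnNge; apply: lt_code; rewrite /= {2}/key eq_sym (negbTE nuz) eqxx.
    by have := key4 x; lia.
  rewrite /L; have [->|nyx] := eqVneq y x; first exact: leqnn.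
  have kx : key x = 4 by apply/eqP; rewrite -key_z E.
  apply/ltnW/lt_code; rewrite kx ltn_neqAle key4 andbT -key_z -E.
  by apply: contraNneq nyx => /val_inj->.
Qed.

End Votes.

(** * Scores for vectors (alpha_1, alpha_2, ..., alpha_2, 0) *)

(** Monotonicity squeezes the middle entries between the equal values at positions 1 and m - 2,
    counted from 0, so a position matters only by being first or last. *)
Lemma admissible_nth m alpha i : 2 < m -> admissible_vector m alpha -> i < m ->
  (alpha`_i = alpha`_1 + (alpha`_0 - alpha`_1) * (i == 0 :> nat)%:Z
            - alpha`_1 * (i == m.-1 :> nat)%:Z)%R.
Proof.
move=> m2 [[sz srt] _ E12 [_ E0] _] im.
have [->|i0] := eqVneq i 0.
  by rewrite (_ : (0 == m.-1) = false) ?mulr1 ?mulr0; lia.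
rewrite mulr0 addr0; have [->|i1] := eqVneq i m.-1.
  by rewrite mulr1 subrr -subn1.
rewrite mulr0 subr0; apply/eqP; rewrite eq_le.
have le_nth : {in [pred j | j < size alpha] &, {homo nth 0%R alpha : a b / a <= b >-> (b <= a)%R}}.
  apply: (@sorted_leq_nth _ (fun a b : int => (b <= a)%R)) => //.
  by move=> b a c ba cb; apply: le_trans ba.
rewrite le_nth ?inE ?sz //=; try lia.
by rewrite {1}E12 le_nth ?inE ?sz //; lia.
Qed.

(** Uniqueness of the indices allows a list of linear orders to be read as a function of the
    index. *)
Lemma Forall2_map_fun (T : eqType) (U S : Type) (R : U -> S -> Prop) (F : T -> U) s ls (x0 : S) :
  uniq s -> List.Forall2 R (map F s) ls ->
  exists2 h : T -> S, ls = map h s & forall i, i \in s -> R (F i) (h i).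
Proof.
elim: s ls => [|x s IH] ls /= Hu H; inversion H; subst.
  by exists (fun=> x0).
case/andP: Hu => xs us; have [h Eh Hh] := IH _ us H4.
exists (fun i => if i == x then y else h i).
  rewrite eqxx; congr cons; rewrite Eh; apply/eq_in_map => i si.
  by case: eqP => // E; rewrite -E si in xs.
move=> i; rewrite inE; case: eqP => [->|_] //= si; exact: Hh.
Qed.

Lemma Forall2_map (T : eqType) (U S : Type) (R : U -> S -> Prop) (F : T -> U) (h : T -> S) s :
  (forall i, i \in s -> R (F i) (h i)) -> List.Forall2 R (map F s) (map h s).
Proof.
elim: s => [|x s IH] H /=; constructor; first by apply: H; rewrite mem_head.
by apply: IH => i si; apply: H; rewrite inE si orbT.
Qed.

Lemma seq_choice (T : eqType) (S : Type) (x0 : S) (P : T -> S -> Prop) (s : seq T) :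
  (forall i, i \in s -> exists y, P i y) -> exists h : T -> S, forall i, i \in s -> P i (h i).
Proof.
elim: s => [|x s IH] H; first by exists (fun=> x0).
have [|h Hh] := IH; first by move=> i si; apply: H; rewrite inE si orbT.
have [y Py] := H x (mem_head _ _).
exists (fun i => if i == x then y else h i) => i; rewrite inE.
by case: eqP => [->|_] //= si; apply: Hh.
Qed.

Section Outcomes.
Variables (m : nat) (alpha : seq int) (T : eqType) (idx : seq T) (vote : T -> level_vote).
Hypotheses (m2 : 2 < m) (adm : admissible_vector m alpha) (Uidx : uniq idx).
Hypothesis proper : forall i, i \in idx -> proper_vote m (vote i).

(** The score minus [alpha_2] per vote, that is a * first(x) - b * last(x) in the notation of the
    overview. *)
Definition net_score (o : T -> nat * nat) (x : nat) : int :=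
  ((alpha`_0 - alpha`_1) * (count (fun i => (o i).1 == x) idx)%:Z
   - alpha`_1 * (count (fun i => (o i).2 == x) idx)%:Z)%R.

Lemma score_net (h : T -> rel 'I_m) o (x : 'I_m) :
  (forall i, i \in idx -> realizes (h i) (o i)) ->
  score alpha (map h idx) x = (alpha`_1 *+ size idx + net_score o x)%R.
Proof.
rewrite /score /net_score big_map; elim: idx => [|i s IH] H.
  by rewrite big_nil /= !mulr0 subrr.
rewrite big_cons IH => [|j sj]; last by apply: H; rewrite inE sj orbT.
have [E1 E2] := H i (mem_head _ _) x.
rewrite (admissible_nth m2 adm (position_lt _ _)) E1 E2 /= mulrS.
rewrite !(eq_sym (nat_of_ord x)) !PoszD !mulrDr opprD -!addrA.
by congr (_ + _)%R; lia.
Qed.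

(** Net scores depend only on the first and last candidates, and each vote may realize any of its
    outcomes independently of the others; linear orders disappear from the problem here. *)
Lemma possible_winner_outcomes (c : 'I_m) :
  possible_winner alpha (@PW m [seq vote_of m (vote i) | i <- idx] c) <->
  exists2 o, forall i, i \in idx -> outcome m (vote i) (o i)
           & forall x, x < m -> (net_score o x <= net_score o c)%R.
Proof.
split=> [[Ls /=]|[o Ho win]].
- case/(Forall2_map_fun (fun _ _ => true) Uidx) => h -> Hh win.
  have [|o Ho] := @seq_choice _ _ (0, 0)
    (fun i o => outcome m (vote i) o /\ realizes (h i) o) idx.
    move=> i si; have [o o1 o2] := linear_extension_outcome (ltnW m2) (proper si) (Hh i si).
    by exists o.
  have Ho2 i : i \in idx -> realizes (h i) (o i) by case/Ho.
  exists o => [i /Ho[]//|x xm]; have := win (Ordinal xm).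
  by rewrite !(score_net _ Ho2) lerD2l.
- have [|h Hh] := @seq_choice _ _ (fun _ _ => true)
    (fun i L => linear_extension (vote_of m (vote i)) L /\ realizes L (o i)) idx.
    move=> i si; have [L L1 L2] := outcome_linear_extension (proper si) (Ho i si).
    by exists L.
  exists (map h idx) => [|x] /=; first by apply: Forall2_map => i /Hh[].
  have Hh2 i : i \in idx -> realizes (h i) (o i) by case/Hh.
  by rewrite !(score_net _ Hh2) lerD2l; apply: win.
Qed.

End Outcomes.

(** * The reduction *)

Lemma count_eq0 (Q : pred nat) s :
  (forall x : nat, x \in s -> Q x = false) -> count Q s = 0.
Proof. by move=> H; rewrite (eq_in_count (a2 := pred0)) ?count_pred0. Qed.

Lemma count_single (Q : pred nat) s x0 :
  uniq s -> x0 \in s -> (forall x : nat, x \in s -> x != x0 -> Q x = false) -> count Q s = Q x0.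
Proof.
move=> us sx0 H; rewrite (eq_in_count (a2 := fun x => Q x0 && (x == x0))).
  case: (Q x0) => /=; last by rewrite count_pred0.
  by rewrite (count_uniq_mem x0 us) sx0.
by move=> x sx; have [->|/(H x sx)->] := eqVneq x x0; rewrite ?andbT ?andbF.
Qed.

Lemma sub_in_count (A B : pred nat) s :
  (forall x : nat, x \in s -> A x -> B x) -> count A s <= count B s.
Proof.
elim: s => //= x s IH H; apply: leq_add.
  by case Ax: (A x); rewrite // H ?mem_head.
by apply: IH => y sy; apply: H; rewrite inE sy orbT.
Qed.

Lemma count_tight (A B : pred nat) s :
  (forall x : nat, x \in s -> A x -> B x) -> count B s <= count A s ->
  forall x : nat, x \in s -> B x -> A x.
Proof.
move=> AB le x sx Bx; apply: contraT => nAx.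
have : count A s + count (fun y => B y && ~~ A y) s <= count B s.
  rewrite -count_predUI [X in _ + X](@count_eq0 _ s) ?addn0.
    by apply: sub_in_count => y sy /= /orP[/(AB y sy)|/andP[]].
  by move=> y _ /=; case: (A y); rewrite ?andbF.
have : 0 < count (fun y => B y && ~~ A y) s.
  by rewrite -has_count; apply/hasP; exists x; rewrite //= Bx.
lia.
Qed.

Lemma count_allpairs (T U V : Type) (F : T -> U -> V) (Q : pred V) s t :
  count Q [seq F x y | x <- s, y <- t] = \sum_(x <- s) count (fun y => Q (F x y)) t.
Proof.
by elim: s => [|x s IH] /=; rewrite ?big_nil // big_cons count_cat IH count_map.
Qed.

Lemma iotaSr k : iota 0 k.+1 = iota 0 k ++ [:: k].
Proof. by rewrite -[k.+1]addn1 iotaD. Qed.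

(** The count is n / 3 rounded up: the number of sets that candidate 1 forces to be selected. *)
Lemma count_multiples3 n : n <= 3 * count (fun i => 3 %| i) (iota 0 n) <= n + 2.
Proof.
suff -> : count (fun i => 3 %| i) (iota 0 n) = (n + 2) %/ 3 by lia.
by elim: n => // n IH; rewrite iotaSr count_cat IH /=; lia.
Qed.

Section Reduction.
Variables (n m : nat) (P : seq nat) (mem : nat -> nat -> bool).
Notation M := (size P).
Notation q := (count (fun i => 3 %| i) (iota 0 n)).

Definition first_mem (p e : nat) : bool := mem p e && ~~ has (mem p) (iota 0 e).

(* The candidate of set [p] that has to be last in the vote of the element [e]. *)
Definition agent (p e : nat) : nat := if first_mem p e then p else p.+1.

Definition user (e x : nat) : bool := has (fun p => mem p e && (x == agent p e)) P.

(* Candidates: 0 is the distinguished one, 1 counts the unselected sets, 2 is a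
   dummy, and the set [p] has the candidates [p], [p + 1] and [p + 2]. An index
   (kd, p, i) is a vote of kind [kd] belonging to the set [p]; [i] numbers
   copies, or is the element for kind 9. *)
Definition top_of (kd p : nat) : nat :=
  nth 0 [:: 0; 2; 1; p.+2; 0; 2; p; p.+1; p.+2; 0; 1; 1] kd.

(** Kinds 2, 3 and 4 are the three votes of a set from the overview and kind 9 holds the element
    votes. The other kinds have a fixed outcome: 0 and 1 provide the last places of candidates 1 and
    0, kind 5 the additional last place of z, kinds 6 to 8 first places of x, y, z, and kinds 10 and
    11 first places of candidate 1. *)
Definition bot_of (kd p i x : nat) : bool :=
  nth (x == 2)
    [:: x == 1; x == 0; x == 2; x == 2; x \in [:: p; p.+2; 2]; x == p.+2;
        x == 2; x == 2; x == 2; (x == 2) || user i x; x == 2; x == 2] kd.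

Definition iso_of (kd p x : nat) : bool :=
  nth false [:: false; false; x == p; x == p.+1] kd.

Definition vote_idx (t : nat * nat * nat) : level_vote :=
  LevelVote (fun x => x == top_of t.1.1 t.1.2) (bot_of t.1.1 t.1.2 t.2) (iso_of t.1.1 t.1.2).

(** The repetitions tune the slacks. Candidate 0 is first 2 + M + n times and last twice. The n + 1
    + M fixed first places of x, y and z are one fewer; candidate 1 has n + 2 + q of them, so at
    most M - q sets can stay unselected. [copies] lists n + 1 + M distinct numbers because set
    positions exceed n. *)
Definition rng (kd : nat) : seq nat * seq nat :=
  let one := [:: 0] in let two := [:: 0; 1] in let copies := iota 0 n.+1 ++ P in
  nth (one, one)
    [:: (one, two); (one, two); (P, one); (P, one); (P, one); (P, one);
        (P, copies); (P, copies); (P, copies);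
        (one, iota 0 n); (one, iota 0 n.+2); (one, [seq i <- iota 0 n | 3 %| i])] kd.

Definition block (kd : nat) : seq (nat * nat * nat) :=
  [seq (kd, p, i) | p <- (rng kd).1, i <- (rng kd).2].

Definition indices : seq (nat * nat * nat) := flatten [seq block kd | kd <- iota 0 12].

Hypothesis P_uniq : uniq P.
Hypothesis P_gt : forall p : nat, p \in P -> n < p.
Hypothesis P_ge4 : forall p : nat, p \in P -> 4 <= p.
Hypothesis P_lt : forall p : nat, p \in P -> p + 2 < m.
Hypothesis P_far : forall p p' : nat, p \in P -> p' \in P -> p != p' -> (p + 4 <= p') || (p' + 4 <= p).
Hypothesis mem3 : forall p : nat, p \in P -> count (mem p) (iota 0 n) = 3.
Hypothesis m_gt4 : 4 < m.

Lemma rng_uniq kd : kd < 12 -> uniq (rng kd).1 && uniq (rng kd).2.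
Proof.
have uc : uniq (iota 0 n.+1 ++ P).
  rewrite cat_uniq P_uniq iota_uniq andbT andTb; apply/hasPn => p /P_gt np.
  by rewrite mem_iota; lia.
have uq : uniq [seq i <- iota 0 n | 3 %| i] by rewrite filter_uniq ?iota_uniq.
move: uc uq (iota_uniq 0 n) (iota_uniq 0 n.+2) => + + + + k12; rewrite /rng.
move: (iota 0 n.+1 ++ P) [seq i <- iota 0 n | 3 %| i] => C Q uC uQ.
move: (iota 0 n) (iota 0 n.+2) => I J uI uJ.
by do 12?[case: kd k12 => [_|kd k12] /=; rewrite ?P_uniq ?uC ?uQ ?uI ?uJ //].
Qed.

Lemma mem_indices (kd p i : nat) :
  ((kd, p, i) \in indices) = [&& kd < 12, p \in (rng kd).1 & i \in (rng kd).2].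
Proof.
apply/flatten_mapP/and3P => [[kd']|[k12 pr ir]].
  rewrite mem_iota => k12 /allpairsP[[p' i'] [/= pr ir [-> -> ->]]].
  by split=> //; lia.
by exists kd; rewrite ?mem_iota //; apply/allpairsP; exists (p, i).
Qed.

Lemma indices_uniq : uniq indices.
Proof.
rewrite /indices.
have H : forall j, j <= 12 -> uniq (flatten [seq block kd | kd <- iota 0 j]).
  elim=> // j IH j12; rewrite iotaSr map_cat flatten_cat /= cats0 cat_uniq.
  rewrite IH ?(ltnW j12) //=; apply/andP; split.
    apply/hasPn => t /allpairsP[[p i] [_ _ ->]]; apply/negP.
    case/flatten_mapP => kd; rewrite mem_iota => kj /allpairsP[[p' i'] [_ _ /= [E _ _]]].
    lia.
  have /andP[u1 u2] := rng_uniq j12.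
  by apply: allpairs_uniq => // [[p i] [p' i']] _ _ /= [-> ->].
exact: H.
Qed.

(** Set positions are at least 4 apart, so p or p + 1 identifies the set. *)
Lemma agent_inj (p p' e e' : nat) : p \in P -> p' \in P -> agent p e = agent p' e' -> p = p'.
Proof.
move=> Pp Pp'; rewrite /agent => E; apply/eqP; apply: contraT => npp'.
have := P_far Pp Pp' npp'; move: E; do 2?case: ifP => _; lia.
Qed.

Lemma user_ge4 e x : user e x -> 4 <= x < m.
Proof.
case/hasP => p Pp /andP[_ /eqP->].
by have := P_ge4 Pp; have := P_lt Pp; rewrite /agent; case: ifP => _; lia.
Qed.

Lemma proper_vote_idx t : t \in indices -> proper_vote m (vote_idx t).
Proof.
case: t => [[kd p] i]; rewrite mem_indices => /and3P[k12 pr ir].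
have lt2 : 2 < m by lia.
have [m0 m1] : 0 < m /\ 1 < m by lia.
have top b (bm : b < m) : b = top_of kd p -> iso_of kd p b = false ->
    exists2 t : 'I_m, tops (vote_idx (kd, p, i)) t & ~~ isos (vote_idx (kd, p, i)) t.
  by move=> E ib; exists (Ordinal bm); rewrite /= ?E // -E ib.
have bot b (bm : b < m) : bot_of kd p i b -> iso_of kd p b = false ->
    exists2 t : 'I_m, bots (vote_idx (kd, p, i)) t & ~~ isos (vote_idx (kd, p, i)) t.
  by move=> E ib; exists (Ordinal bm); rewrite //= ib.
have far : kd \in iota 2 7 -> [/\ 4 <= p, p < m, p.+1 < m & p.+2 < m].
  rewrite mem_iota => hk; have Pp : p \in P.
    by clear - hk pr; do 9?[case: kd hk pr => [|kd] // hk pr].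
  by have := P_ge4 Pp; have := P_lt Pp; split; lia.
split.
- move=> x; apply/negP => /andP[/= /eqP-> {top bot}]; clear pr ir.
  do 12?[case: kd k12 far => [|kd] k12 far]; rewrite /bot_of /top_of /= ?inE //;
    try (by case: (far isT) => *; lia).
  by move/user_ge4.
- clear bot pr ir; do 12?[case: kd k12 far top => [|kd] k12 far top]; rewrite //;
    try (by apply: (top 0)); try (by apply: (top 1)); try (by apply: (top 2));
    case: (far isT) => p4 pm0 pm1 pm2;
    first [by apply: (top 1) => //; rewrite /iso_of /=; lia
          | by apply: (top p) => //; rewrite /iso_of /=; lia
          | by apply: (top p.+1) => //; rewrite /iso_of /=; lia
          | by apply: (top p.+2) => //; rewrite /iso_of /=; lia].
- clear top pr ir; do 12?[case: kd k12 far bot => [|kd] k12 far bot]; rewrite //;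
    try (by apply: (bot 0)); try (by apply: (bot 1)); try (by apply: (bot 2));
    case: (far isT) => p4 pm0 pm1 pm2;
    first [by apply: (bot 2); rewrite /bot_of /iso_of /= ?inE ?eqxx ?orbT //; lia
          | by apply: (bot p.+2); rewrite /bot_of /iso_of /= ?eqxx].
Qed.

(** * Numbers of first and last places of each candidate *)

Section Counts.
Variable o : nat * nat * nat -> nat * nat.
Hypothesis o_valid : forall t, t \in indices -> outcome m (vote_idx t) (o t).

Lemma count_block (Q : pred (nat * nat * nat)) (R : pred nat) kd :
  kd < 12 -> (forall p i : nat, (kd, p, i) \in indices -> Q (kd, p, i) = R p) ->
  count Q (block kd) = count R (rng kd).1 * size (rng kd).2.
Proof.
move=> k12 QR; rewrite /block count_allpairs.
have {}QR (p i : nat) : p \in (rng kd).1 -> i \in (rng kd).2 -> Q (kd, p, i) = R p.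
  by move=> h1 h2; apply: QR; rewrite mem_indices k12 h1 h2.
elim: (rng kd).1 QR => [|p s IH] QR; first by rewrite big_nil.
rewrite big_cons /= mulnDl IH => [|p' i sp']; last by apply: QR; rewrite inE sp' orbT.
congr addn; rewrite (eq_in_count (a2 := fun=> R p)) => [|i si].
  by case: (R p); rewrite ?count_predT ?count_pred0 ?mul1n.
by apply: QR; rewrite ?mem_head.
Qed.

Lemma iso_of_false kd p x : kd \notin [:: 2; 3] -> iso_of kd p x = false.
Proof. by case: kd => [|[|[|[|kd]]]] //; rewrite /iso_of /= nth_nil. Qed.

Lemma count_cst (b : bool) (s : seq nat) : count (fun=> b) s = b * size s.
Proof. by case: b; rewrite ?count_predT ?count_pred0 ?mul1n. Qed.

Lemma count_indices (Q : pred (nat * nat * nat)) : count Q indices =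
  let b kd := count Q (block kd) in
  b 0 + (b 1 + (b 2 + (b 3 + (b 4 + (b 5 + (b 6 + (b 7 + (b 8 + (b 9 + (b 10 + (b 11 + 0))))))))))).
Proof. by rewrite /indices count_flatten -map_comp. Qed.

Lemma outcome_idx (kd p i : nat) : (kd, p, i) \in indices ->
  [/\ ((o (kd, p, i)).1 == top_of kd p) || iso_of kd p (o (kd, p, i)).1,
      bot_of kd p i (o (kd, p, i)).2 || iso_of kd p (o (kd, p, i)).2
    & (o (kd, p, i)).1 != (o (kd, p, i)).2].
Proof. by move/o_valid => /and5P[]. Qed.

(** The first candidate is open only in kinds 2 and 3. *)
Lemma count_first x : count (fun t => (o t).1 == x) indices =
  (x == 0) * (2 + M + n) + (x == 2) * (2 + M) + (x == 1) * (n + 2 + q)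
  + count (fun p => (o (2, p, 0)).1 == x) P + count (fun p => (o (3, p, 0)).1 == x) P
  + (n + 1 + M) * (count (fun p => p == x) P + count (fun p => p.+1 == x) P
                   + count (fun p => p.+2 == x) P).
Proof.
pose Q (t : nat * nat * nat) := (o t).1 == x.
have fix_ kd : kd < 12 -> kd \notin [:: 2; 3] ->
    count Q (block kd) = count (fun p => top_of kd p == x) (rng kd).1 * size (rng kd).2.
  move=> k12 nk; apply: count_block => // p i /outcome_idx[+ _ _].
  by rewrite iso_of_false // orbF /Q => /eqP->.
have var kd : kd \in [:: 2; 3] ->
    count Q (block kd) = count (fun p => (o (kd, p, 0)).1 == x) P.
  move=> hk; rewrite (@count_block _ (fun p => (o (kd, p, 0)).1 == x)).
  - by move: hk; rewrite !inE => /orP[]/eqP->; rewrite muln1.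
  - by move: hk; rewrite !inE => /orP[]/eqP->.
  - move=> p i; rewrite mem_indices => /and3P[_ _].
    by move: hk; rewrite !inE => /orP[]/eqP-> /=; rewrite inE => /eqP->.
rewrite count_indices; lazy zeta beta.
rewrite -/Q !(var 2, var 3) // !fix_ // /rng.
cbv zeta; set C := iota 0 n.+1 ++ P; set J := iota 0 n.+2; set I3 := filter _ _.
have sC : size C = n + 1 + M by rewrite size_cat size_iota addn1.
have sJ : size J = n.+2 by rewrite size_iota.
have sI : size I3 = q by rewrite size_filter.
clearbody C J I3.
rewrite /top_of /= sC sJ sI size_iota !count_cst !(eq_sym x).
by lia.
Qed.

(** The last candidate is open only in kinds 2, 3, 4 and 9. *)
Lemma count_last x : count (fun t => (o t).2 == x) indices =
  (x == 1) * 2 + (x == 0) * 2 + count (fun p => (o (2, p, 0)).2 == x) P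
  + count (fun p => (o (3, p, 0)).2 == x) P + count (fun p => (o (4, p, 0)).2 == x) P
  + count (fun p => p.+2 == x) P + (x == 2) * (3 * M * (n + 1 + M) + n + 2 + q)
  + count (fun e => (o (9, 0, e)).2 == x) (iota 0 n).
Proof.
pose Q (t : nat * nat * nat) := (o t).2 == x.
pose bot kd p := nth 2 [:: 1; 0; 2; 2; 2; p.+2] kd.
have fix_ kd : kd < 12 -> kd \notin [:: 2; 3; 4; 9] ->
    count Q (block kd) = count (fun p => bot kd p == x) (rng kd).1 * size (rng kd).2.
  move=> k12 nk; apply: count_block => // p i /outcome_idx[_ + _].
  rewrite iso_of_false; last by move: nk; rewrite !inE; case: (kd == 2); case: (kd == 3).
  rewrite orbF /Q => H; suff -> : (o (kd, p, i)).2 = bot kd p by [].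
  apply/eqP; move: nk k12 H; rewrite /bot_of /bot.
  by do 12?[case: kd => [|kd] //=].
have var kd : kd \in [:: 2; 3; 4] ->
    count Q (block kd) = count (fun p => (o (kd, p, 0)).2 == x) P.
  move=> hk; rewrite (@count_block _ (fun p => (o (kd, p, 0)).2 == x)).
  - by move: hk; rewrite !inE => /or3P[]/eqP->; rewrite muln1.
  - by move: hk; rewrite !inE => /or3P[]/eqP->.
  - move=> p i; rewrite mem_indices => /and3P[_ _].
    by move: hk; rewrite !inE => /or3P[]/eqP-> /=; rewrite inE => /eqP->.
have elt : count Q (block 9) = count (fun e => (o (9, 0, e)).2 == x) (iota 0 n).
  by rewrite /block count_allpairs big_seq1.
rewrite count_indices; lazy zeta beta.
rewrite -/Q !(var 2, var 3, var 4, elt) // !fix_ // /rng.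
cbv zeta; set C := iota 0 n.+1 ++ P; set J := iota 0 n.+2; set I3 := filter _ _.
have sC : size C = n + 1 + M by rewrite size_cat size_iota addn1.
have sJ : size J = n.+2 by rewrite size_iota.
have sI : size I3 = q by rewrite size_filter.
clearbody C J I3.
rewrite /bot /= sC sJ sI !count_cst !(eq_sym x).
by lia.
Qed.

Lemma far_cases (p p' : nat) : p \in P -> p' \in P -> [|| p == p', p + 4 <= p' | p' + 4 <= p].
Proof. by move=> Pp Pp'; case: eqVneq => //= npp'; apply: P_far. Qed.

Lemma set_votes (p : nat) : p \in P ->
  [/\ [/\ ((o (2, p, 0)).1 == 1) || ((o (2, p, 0)).1 == p),
          ((o (2, p, 0)).2 == 2) || ((o (2, p, 0)).2 == p)
        & (o (2, p, 0)).1 != (o (2, p, 0)).2],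
      [/\ ((o (3, p, 0)).1 == p.+2) || ((o (3, p, 0)).1 == p.+1),
          ((o (3, p, 0)).2 == 2) || ((o (3, p, 0)).2 == p.+1)
        & (o (3, p, 0)).1 != (o (3, p, 0)).2]
    & [|| (o (4, p, 0)).2 == p, (o (4, p, 0)).2 == p.+2 | (o (4, p, 0)).2 == 2] ].
Proof.
move=> Pp; have H kd : kd \in [:: 2; 3; 4] -> (kd, p, 0) \in indices.
  by rewrite mem_indices !inE => /or3P[]/eqP->; rewrite /= Pp.
split; first by case: (outcome_idx (H 2 isT)).
  by case: (outcome_idx (H 3 isT)).
by case: (outcome_idx (H 4 isT)) => _; rewrite /bot_of /= !inE /iso_of /= orbF.
Qed.

Lemma elt_vote e : e < n -> ((o (9, 0, e)).2 == 2) || user e (o (9, 0, e)).2.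
Proof.
move=> en; have H : (9, 0, e) \in indices by rewrite mem_indices /= mem_iota.
by case: (outcome_idx H) => _; rewrite /bot_of /= /iso_of /= orbF.
Qed.

Lemma elt_vote_agent (p e : nat) : p \in P -> e < n ->
  ((o (9, 0, e)).2 == p) || ((o (9, 0, e)).2 == p.+1) ->
  mem p e && ((o (9, 0, e)).2 == agent p e).
Proof.
move=> Pp en E; have := elt_vote en; have p4 := P_ge4 Pp.
case/orP => [|/hasP[p' Pp' /andP[me /eqP Ea]]]; first by lia.
suff -> : p = p' by rewrite me Ea eqxx.
by have := far_cases Pp Pp'; move: Ea; rewrite /agent; case: ifP => _; lia.
Qed.

Lemma elt_vote_other x e : e < n -> (o (9, 0, e)).2 == x -> x != 2 ->
  exists2 p : nat, p \in P & (x == p) || (x == p.+1).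
Proof.
move=> en /eqP Ex x2; have := elt_vote en; rewrite Ex (negbTE x2) /=.
by case/hasP => p Pp /andP[_ /eqP ->]; exists p; rewrite // /agent; case: ifP; rewrite eqxx ?orbT.
Qed.

Lemma count_elt_eq0 x : (forall p : nat, p \in P -> (x != p) && (x != p.+1)) -> x != 2 ->
  count (fun e => (o (9, 0, e)).2 == x) (iota 0 n) = 0.
Proof.
move=> far x2; apply: count_eq0 => e; rewrite mem_iota /= add0n => en.
apply/negP => /(elt_vote_other en)/(_ x2)[p /far /andP[/negbTE-> /negbTE->]] //.
Qed.

Ltac count0 := apply: count_eq0; let p' := fresh "p'" in let Pp' := fresh "Pp'" in
  move=> p' Pp'; cbv beta; have := P_ge4 Pp'; case: (set_votes Pp') => [[? ? ?] [? ? ?] ?];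
  try match goal with H : is_true (?p \in P) |- _ =>
    lazymatch p with p' => fail | _ => have := far_cases Pp' H end end; lia.

Ltac count1 p Pp := rewrite (@count_single _ P p) //; let p' := fresh "p'" in
  let Pp' := fresh "Pp'" in move=> p' Pp' ?; cbv beta; have := P_ge4 Pp';
  have := far_cases Pp' Pp; case: (set_votes Pp') => [[? ? ?] [? ? ?] ?]; lia.

Lemma counts_c : count (fun t => (o t).1 == 0) indices = 2 + M + n /\
                 count (fun t => (o t).2 == 0) indices = 2.
Proof.
split.
  rewrite count_first.
  have -> : count (fun p => (o (2, p, 0)).1 == 0) P = 0 by count0.
  have -> : count (fun p => (o (3, p, 0)).1 == 0) P = 0 by count0.
  have -> : count (fun p => p == 0) P = 0 by count0.
  by rewrite /= !count_pred0; lia.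
rewrite count_last.
have -> : count (fun p => (o (2, p, 0)).2 == 0) P = 0 by count0.
have -> : count (fun p => (o (3, p, 0)).2 == 0) P = 0 by count0.
have -> : count (fun p => (o (4, p, 0)).2 == 0) P = 0 by count0.
rewrite count_elt_eq0 ?count_pred0 //= => p Pp; have := P_ge4 Pp; lia.
Qed.

Lemma counts_N :
  count (fun t => (o t).1 == 1) indices
    = n + 2 + q + count (fun p => (o (2, p, 0)).1 == 1) P /\
  count (fun t => (o t).2 == 1) indices = 2.
Proof.
split.
  rewrite count_first.
  have -> : count (fun p => (o (3, p, 0)).1 == 1) P = 0 by count0.
  have -> : count (fun p => p == 1) P = 0 by count0.
  have -> : count (fun p => p.+1 == 1) P = 0 by count0.
  have -> : count (fun p => p.+2 == 1) P = 0 by count0.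
  by rewrite /=; lia.
rewrite count_last.
have -> : count (fun p => (o (2, p, 0)).2 == 1) P = 0 by count0.
have -> : count (fun p => (o (3, p, 0)).2 == 1) P = 0 by count0.
have -> : count (fun p => (o (4, p, 0)).2 == 1) P = 0 by count0.
have -> : count (fun p => p.+2 == 1) P = 0 by count0.
rewrite count_elt_eq0 //= => p Pp; have := P_ge4 Pp; lia.
Qed.

Lemma counts_D : count (fun t => (o t).1 == 2) indices = 2 + M /\
  2 <= count (fun t => (o t).2 == 2) indices.
Proof.
split; last by rewrite count_last /=; lia.
rewrite count_first.
have -> : count (fun p => (o (2, p, 0)).1 == 2) P = 0 by count0.
have -> : count (fun p => (o (3, p, 0)).1 == 2) P = 0 by count0.
have -> : count (fun p => p == 2) P = 0 by count0.
have -> : count (fun p => p.+1 == 2) P = 0 by count0.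
have -> : count (fun p => p.+2 == 2) P = 0 by count0.
by rewrite /=; lia.
Qed.

Lemma counts_x (p : nat) : p \in P ->
  count (fun t => (o t).1 == p) indices = n + 1 + M + ((o (2, p, 0)).1 == p) /\
  count (fun t => (o t).2 == p) indices = ((o (2, p, 0)).2 == p) + ((o (4, p, 0)).2 == p)
    + count (fun e => (o (9, 0, e)).2 == p) (iota 0 n).
Proof.
move=> Pp; have p4 := P_ge4 Pp.
have [p0 p1 p2] : [/\ (p == 0) = false, (p == 1) = false & (p == 2) = false] by split; lia.
split.
  rewrite count_first p0 p1 p2.
  have -> : count (fun i => (o (2, i, 0)).1 == p) P = ((o (2, p, 0)).1 == p) by count1 p Pp.
  have -> : count (fun i => (o (3, i, 0)).1 == p) P = 0 by count0.
  have -> : count (fun i => i == p) P = (p == p) by count1 p Pp.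
  have -> : count (fun i => i.+1 == p) P = 0 by count0.
  have -> : count (fun i => i.+2 == p) P = 0 by count0.
  by rewrite eqxx; lia.
rewrite count_last p0 p1 p2.
have -> : count (fun i => (o (2, i, 0)).2 == p) P = ((o (2, p, 0)).2 == p) by count1 p Pp.
have -> : count (fun i => (o (3, i, 0)).2 == p) P = 0 by count0.
have -> : count (fun i => (o (4, i, 0)).2 == p) P = ((o (4, p, 0)).2 == p) by count1 p Pp.
have -> : count (fun i => i.+2 == p) P = 0 by count0.
by lia.
Qed.

Lemma counts_y (p : nat) : p \in P ->
  count (fun t => (o t).1 == p.+1) indices = n + 1 + M + ((o (3, p, 0)).1 == p.+1) /\
  count (fun t => (o t).2 == p.+1) indices = ((o (3, p, 0)).2 == p.+1)
    + count (fun e => (o (9, 0, e)).2 == p.+1) (iota 0 n).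
Proof.
move=> Pp; have p4 := P_ge4 Pp.
have [p0 p1 p2] : [/\ (p.+1 == 0) = false, (p.+1 == 1) = false & (p.+1 == 2) = false].
  by split; lia.
split.
  rewrite count_first p0 p1 p2.
  have -> : count (fun i => (o (2, i, 0)).1 == p.+1) P = 0 by count0.
  have -> : count (fun i => (o (3, i, 0)).1 == p.+1) P = ((o (3, p, 0)).1 == p.+1).
    by count1 p Pp.
  have -> : count (fun i => i == p.+1) P = 0 by count0.
  have -> : count (fun i => i.+1 == p.+1) P = (p.+1 == p.+1) by count1 p Pp.
  have -> : count (fun i => i.+2 == p.+1) P = 0 by count0.
  by rewrite eqxx; lia.
rewrite count_last p0 p1 p2.
have -> : count (fun i => (o (2, i, 0)).2 == p.+1) P = 0 by count0.
have -> : count (fun i => (o (3, i, 0)).2 == p.+1) P = ((o (3, p, 0)).2 == p.+1).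
  by count1 p Pp.
have -> : count (fun i => (o (4, i, 0)).2 == p.+1) P = 0 by count0.
have -> : count (fun i => i.+2 == p.+1) P = 0 by count0.
by lia.
Qed.

Lemma counts_z (p : nat) : p \in P ->
  count (fun t => (o t).1 == p.+2) indices = n + 1 + M + ((o (3, p, 0)).1 == p.+2) /\
  count (fun t => (o t).2 == p.+2) indices = 1 + ((o (4, p, 0)).2 == p.+2).
Proof.
move=> Pp; have p4 := P_ge4 Pp.
have [p0 p1 p2] : [/\ (p.+2 == 0) = false, (p.+2 == 1) = false & (p.+2 == 2) = false].
  by split; lia.
split.
  rewrite count_first p0 p1 p2.
  have -> : count (fun i => (o (2, i, 0)).1 == p.+2) P = 0 by count0.
  have -> : count (fun i => (o (3, i, 0)).1 == p.+2) P = ((o (3, p, 0)).1 == p.+2).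
    by count1 p Pp.
  have -> : count (fun i => i == p.+2) P = 0 by count0.
  have -> : count (fun i => i.+1 == p.+2) P = 0 by count0.
  have -> : count (fun i => i.+2 == p.+2) P = (p.+2 == p.+2) by count1 p Pp.
  by rewrite eqxx; lia.
rewrite count_last p0 p1 p2 count_elt_eq0 ?p2 //; last first.
  by move=> p' Pp'; have := far_cases Pp Pp'; lia.
have -> : count (fun i => (o (2, i, 0)).2 == p.+2) P = 0 by count0.
have -> : count (fun i => (o (3, i, 0)).2 == p.+2) P = 0 by count0.
have -> : count (fun i => (o (4, i, 0)).2 == p.+2) P = ((o (4, p, 0)).2 == p.+2).
  by count1 p Pp.
have -> : count (fun i => i.+2 == p.+2) P = (p.+2 == p.+2) by count1 p Pp.
by rewrite eqxx; lia.
Qed.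

(** Padding candidates are never first, so their net score cannot be positive. *)
Lemma counts_other x : 2 < x -> (forall p : nat, p \in P -> [&& x != p, x != p.+1 & x != p.+2]) ->
  count (fun t => (o t).1 == x) indices = 0.
Proof.
move=> x2 far; rewrite count_first.
have [p0 p1 p2] : [/\ (x == 0) = false, (x == 1) = false & (x == 2) = false] by split; lia.
rewrite p0 p1 p2.
have z (F : nat -> nat) : (forall p : nat, p \in P -> [|| F p == 1, F p == p, F p == p.+1 | F p == p.+2]) ->
    count (fun p => F p == x) P = 0.
  by move=> HF; apply: count_eq0 => p Pp; have := HF p Pp; have := far p Pp; lia.
rewrite (z (fun p => (o (2, p, 0)).1)); last by move=> p /set_votes[[? _ _] _ _]; lia.
rewrite (z (fun p => (o (3, p, 0)).1)); last by move=> p /set_votes[_ [? _ _] _]; lia.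
rewrite (z id); last by move=> p _; rewrite /= eqxx orbT.
rewrite (z succn); last by move=> p _; rewrite /= eqxx !orbT.
rewrite (z (fun p => p.+2)); last by move=> p _; rewrite /= eqxx !orbT.
by rewrite muln0.
Qed.

End Counts.

(** * Exact covers and incidence counts *)

Definition exact_cover : Prop :=
  exists J : pred nat, forall e, e < n -> count (fun p => J p && mem p e) P = 1.

Lemma count_first_mem (p : nat) : p \in P -> count (first_mem p) (iota 0 n) = 1.
Proof.
move=> Pp; have := mem3 Pp; move: (n) => k.
suff -> : count (first_mem p) (iota 0 k) = (0 < count (mem p) (iota 0 k)) by move=> ->.
elim: k => // k IH; rewrite iotaSr !count_cat IH /= /first_mem has_count.
by case: (mem p k); case: (count (mem p) (iota 0 k)) => [|c] //=; lia.
Qed.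

Lemma count_rest_mem (p : nat) : p \in P ->
  count (fun e => mem p e && ~~ first_mem p e) (iota 0 n) = 2.
Proof.
move=> Pp; have := mem3 Pp; have := count_first_mem Pp.
move: (iota 0 n) => s.
suff -> : count (mem p) s = count (first_mem p) s + count (fun e => mem p e && ~~ first_mem p e) s.
  by lia.
elim: s => //= e s ->; rewrite /first_mem.
by case: (mem p e) => //=; case: has => /=; lia.
Qed.

(** Double counting of the pairs of an element and a selected set containing it. *)
Lemma sum_count_mem (J : pred nat) :
  \sum_(e <- iota 0 n) count (fun p => J p && mem p e) P = 3 * count J P.
Proof.
(* The induction runs over lists of members of [P], which still have three elements each. *)
have : {subset P <= P} by [].
elim: {1 3 4}P => [|p s IH] sP; first by rewrite big1.
rewrite /= big_split /= IH => [|p' sp']; last by apply: sP; rewrite inE sp' orbT.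
have Pp : p \in P by apply: sP; rewrite mem_head.
rewrite mulnDr; congr addn; case: (J p) => /=; last by rewrite big1_eq.
by rewrite -(mem3 Pp) muln1 -sum1_count [RHS]big_mkcond.
Qed.

Lemma sum_le1_tight (c : nat -> nat) (s : seq nat) :
  (forall e : nat, e \in s -> c e <= 1) -> size s <= \sum_(e <- s) c e ->
  forall e : nat, e \in s -> c e = 1.
Proof.
have ub (t : seq nat) : (forall e : nat, e \in t -> c e <= 1) -> \sum_(e <- t) c e <= size t.
  elim: t => [|e t IH] H; rewrite ?big_nil // big_cons /= -add1n leq_add ?H ?mem_head //.
  by apply: IH => e' te'; apply: H; rewrite inE te' orbT.
elim: s => // e s IH H; rewrite big_cons /= => le.
have Hs e' : e' \in s -> c e' <= 1 by move=> h; apply: H; rewrite inE h orbT.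
have := ub s Hs; have := H e (mem_head _ _) => c1 us.
move=> e'; rewrite inE => /predU1P[->|]; first by lia.
by apply: IH => //; lia.
Qed.

(** * Winning outcomes versus exact covers *)

Section Weights.
Variables a b : int.
Hypotheses (b_gt0 : (0 < b)%R) (ab : (b < a)%R).

Definition wins (o : nat * nat * nat -> nat * nat) : Prop :=
  forall x, x < m ->
    (a * (count (fun t => (o t).1 == x) indices)%:Z
     - b * (count (fun t => (o t).2 == x) indices)%:Z
     <= a * (count (fun t => (o t).1 == 0) indices)%:Z
        - b * (count (fun t => (o t).2 == 0) indices)%:Z)%R.

Lemma exact_cover_of_winner o :
  (forall t, t \in indices -> outcome m (vote_idx t) (o t)) -> wins o -> exact_cover.
Proof.
move=> ov win; have [c1 c2] := counts_c ov.
(* Against candidate 0 the inequality reads a (f - 1) + b (2 - l) <= 0, which fails for f >= 1 and l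
   < 2. *)
have slack x f l : x < m ->
    count (fun t => (o t).1 == x) indices = n + 1 + M + f ->
    count (fun t => (o t).2 == x) indices = l -> 0 < f -> 2 <= l.
  move=> xm E1 E2 f0; rewrite leqNgt; apply/negP => l2.
  have := win x xm; rewrite c1 c2 E1 E2 !PoszD.
  have : (a <= a * f)%R by rewrite ler_peMr //; lia.
  have : (b * l <= b)%R by rewrite ger_pMr //; lia.
  by rewrite !mulrDr; lia.
pose J (p : nat) := (o (2, p, 0)).1 == p.
(* Candidate 1 is first in the kind 2 vote of every unselected set, so its inequality bounds their
   number by M - q. *)
have cntJ : q <= count J P.
  have [n1 n2] := counts_N ov.
  have := win 1 ltac:(lia); rewrite c1 c2 n1 n2 lerD2r ler_pM2l ?lez_nat; last by lia.
  suff -> : M = count J P + count (fun p : nat => (o (2, p, 0)).1 == 1) P by lia.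
  rewrite -(count_predC J P); congr addn; apply: eq_in_count => p Pp /=.
  by have [[? _ _] _ _] := set_votes ov Pp; have := P_ge4 Pp; rewrite /J; lia.
have key (p e : nat) : p \in P -> J p -> e < n -> mem p e -> (o (9, 0, e)).2 = agent p e.
  move=> Pp Jp en me; have pm := P_lt Pp.
  have [[s1 s2 s3] [s4 s5 s6] s7] := set_votes ov Pp.
  have [x1 x2] := counts_x ov Pp; have [y1 y2] := counts_y ov Pp.
  have [z1 z2] := counts_z ov Pp.
  have sub1 e' : e' \in iota 0 n -> (o (9, 0, e')).2 == p -> first_mem p e'.
    rewrite mem_iota /= add0n => en' Ep.
    have := elt_vote_agent ov Pp en'; rewrite Ep => /(_ isT)/andP[_].
    by rewrite (eqP Ep) /agent; case: ifP => // _; clear; lia.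
  have cx : count (fun e => (o (9, 0, e)).2 == p) (iota 0 n) <= 1.
    by apply: leq_trans (sub_in_count sub1) _; rewrite count_first_mem.
  have [pm0 pm1 pm2] : [/\ p < m, p.+1 < m & p.+2 < m] by clear - pm; split; lia.
  have Hx := slack p _ _ pm0 x1 x2; rewrite /J in Jp; rewrite Jp in Hx.
  have n22 : ((o (2, p, 0)).2 == p) = false by clear - s3 Jp; lia.
  have {}Hx := Hx isT; rewrite n22 add0n in Hx.
  (* x is first in its own vote and last in at most one element vote, so its second last place must
     come from kind 4. *)
  have o4 : (o (4, p, 0)).2 == p by case: (_ == p) Hx => //; rewrite add0n => /leq_trans/(_ cx).
  have n4 : ((o (4, p, 0)).2 == p.+2) = false by clear - o4; lia.
  (* Only the last place of kind 5 is left to z, one too few for a first place in kind 3. *)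
  have Hz := slack p.+2 _ _ pm2 z1 z2; rewrite n4 in Hz.
  have n3 : ((o (3, p, 0)).1 == p.+2) = false by clear - Hz; lia.
  have o3 : (o (3, p, 0)).1 == p.+1 by clear - s4 n3; lia.
  have n32 : ((o (3, p, 0)).2 == p.+1) = false by clear - s6 o3; lia.
  have Hy := slack p.+1 _ _ pm1 y1 y2; rewrite o3 n32 add0n in Hy.
  have {}Hy := Hy isT.
  have sub e' : e' \in iota 0 n -> (o (9, 0, e')).2 == p.+1 -> mem p e' && ~~ first_mem p e'.
    rewrite mem_iota /= add0n => en' Ep.
    have := elt_vote_agent ov Pp en'; rewrite Ep orbT => /(_ isT)/andP[-> /=].
    by rewrite (eqP Ep) /agent; case: ifP => // _; clear; lia.
  have ein : e \in iota 0 n by rewrite mem_iota.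
  (* The debts of x and y equal the numbers of element votes that can pay them, so every such vote
     has to pay. *)
  rewrite /agent; case fe: (first_mem p e); apply/eqP.
    by apply: (count_tight sub1) => //; rewrite count_first_mem //; move: Hx; rewrite o4.
  by apply: (count_tight sub) => //; rewrite ?count_rest_mem ?me ?fe.
exists J => e en; have ein : e \in iota 0 n by rewrite mem_iota.
(* Two selected sets containing the same element would share its last place, so multiplicities are
   at most 1; at least 3 * q >= n incidences then leave no element uncovered. *)
apply: (@sum_le1_tight (fun e => count (fun p => J p && mem p e) P) _ _ _ e ein).
  move=> e' ; rewrite mem_iota /= add0n => en'.
  case E: (has (fun p => J p && mem p e') P); last first.
    by move/negbT: E; rewrite has_count -leqNgt leqn0 => /eqP->.
  case/hasP: E => p Pp /andP[Jp mp].
  rewrite (@count_single _ P p) ?leq_b1 // => p' Pp' npp'; apply/negP => /andP[Jp' mp'].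
  have E := key p' e' Pp' Jp' en' mp'; rewrite (key p e') // in E.
  by rewrite (agent_inj Pp Pp' E) eqxx in npp'.
rewrite size_iota sum_count_mem.
by have := count_multiples3 n; lia.
Qed.

Lemma winner_of_exact_cover : exact_cover ->
  exists2 o, forall t, t \in indices -> outcome m (vote_idx t) (o t) & wins o.
Proof.
case=> J HJ.
have cntJ : count J P = q /\ q <= M.
  suff E : n = 3 * count J P by have := count_multiples3 n; have := count_size J P; lia.
  rewrite -sum_count_mem (eq_big_seq (fun=> 1)) ?sum1_size ?size_iota // => e.
  by rewrite mem_iota => en; apply: HJ.
(* The selected set that covers [e]; the default 0 is not reached for e < n. *)
pose owner e := nth 0 P (find (fun p => J p && mem p e) P).
have ownerP e : e < n -> [/\ owner e \in P, J (owner e) & mem (owner e) e].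
  move=> en; have h : has (fun p => J p && mem p e) P by rewrite has_count HJ.
  have := nth_find 0 h; rewrite -/(owner e) => /andP[Jo mo].
  by split=> //; rewrite mem_nth -?has_find.
have owner_uniq (p e : nat) : e < n -> p \in P -> J p -> mem p e -> owner e = p.
  move=> en Pp Jp mp; have [Po Jo mo] := ownerP e en.
  apply/eqP; apply: contraT => nop.
  have := HJ e en; have : count (fun x => (x == owner e) || (x == p)) P
      <= count (fun p => J p && mem p e) P.
    by apply: sub_in_count => x _ /orP[]/eqP->; rewrite ?Jo ?mo ?Jp ?mp.
  have := count_predUI (pred1 (owner e)) (pred1 p) P.
  rewrite (count_uniq_mem _ P_uniq) Po (count_uniq_mem _ P_uniq) Pp.
  rewrite (@count_eq0 (predI _ _)) => [|x _ /=].
    by rewrite /predU /= addn0 => ->; lia.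
  by case: eqP => // ->; rewrite (negbTE nop).
(* A selected set has x and y first and lets x be last in kind 4. For an unselected one z is first
   in kind 3 and pays by being last in kind 4. The vote of an element goes to the agent of its
   owner. *)
pose o (t : nat * nat * nat) : nat * nat :=
  let: (kd, p, i) := t in
  nth (0, 0) [:: (0, 1); (2, 0); if J p then (p, 2) else (1, p);
    if J p then (p.+1, 2) else (p.+2, p.+1); (0, if J p then p else p.+2); (2, p.+2);
    (p, 2); (p.+1, 2); (p.+2, 2); (0, agent (owner i) i); (1, 2); (1, 2)] kd.
have ov t : t \in indices -> outcome m (vote_idx t) (o t).
  case: t => [[kd p] i]; rewrite mem_indices => /and3P[k12 pr ir].
  have [m0 m1 m2] : [/\ 0 < m, 1 < m & 2 < m] by split; lia.
  have [k9|n9] := eqVneq kd 9.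
    move: ir; rewrite k9 /= mem_iota /= add0n => iN.
    have [Po Jo mo] := ownerP i iN.
    have us : user i (agent (owner i) i).
      by apply/hasP; exists (owner i); rewrite // mo eqxx.
    have := user_ge4 us.
    by rewrite /outcome /o /= /top_of /bot_of /iso_of /= us m0 !orbT /=; lia.
  have [far|nfar] := boolP (kd \in iota 2 7).
    have Pp : p \in P.
      clear - far pr; move: far pr; rewrite mem_iota.
      by do 9?[case: kd => [|kd] //].
    have := P_ge4 Pp; have := P_lt Pp => pm p4; clear - far pm p4 m_gt4.
    rewrite /outcome /o /vote_idx /= /top_of /bot_of /iso_of; move: far; rewrite mem_iota.
    do 9?[case: kd => [|kd] //=]; move=> _; rewrite ?inE; case: (J p) => /=; rewrite ?eqxx; lia.
  clear - k12 n9 nfar m0 m1 m2; move: k12 n9 nfar; rewrite mem_iota.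
  rewrite /outcome /o /vote_idx /= /top_of /bot_of /iso_of.
  by do 12?[case: kd => [|kd] //=]; rewrite ?m0 ?m1 ?m2.
exists o => // x xm; have [c1 c2] := counts_c ov; rewrite c1 c2.
have [-> | x0] := eqVneq x 0; first by rewrite c1 c2.
have [-> | x1] := eqVneq x 1.
  have [n1 n2] := counts_N ov; rewrite n1 n2 lerD2r ler_pM2l ?lez_nat; last by lia.
  suff : count J P + count (fun p : nat => (o (2, p, 0)).1 == 1) P <= M by lia.
  rewrite -[X in _ <= X](count_predC J P) leq_add2l; apply: sub_in_count => p Pp /=.
  by case: (J p) => //=; have := P_ge4 Pp; lia.
have [-> | x2] := eqVneq x 2.
  have [d1 d2] := counts_D ov; rewrite d1.
  set l := count _ _ in d2 *; have : (b * 2 <= b * l%:Z)%R by rewrite ler_pM2l //; lia.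
  have : (0 <= a * n)%R by apply: mulr_ge0; lia.
  by rewrite !PoszD !mulrDr; lia.
(* Without an extra first place a single last place suffices, because b < a; with one, two are
   required. *)
have slack f l : count (fun t => (o t).1 == x) indices = n + 1 + M + f ->
    f + l <= count (fun t => (o t).2 == x) indices -> f <= 1 -> 0 < l ->
    (a * (count (fun t => (o t).1 == x) indices)%:Z
     - b * (count (fun t => (o t).2 == x) indices)%:Z <= a * (2 + M + n)%:Z - b * 2)%R.
  move=> ->; set L := count _ indices => le f1 l0.
  have : (b * (f + l)%:Z <= b * L%:Z)%R by rewrite ler_pM2l.
  have : (b * 1 <= b * l%:Z)%R by rewrite ler_pM2l //; lia.
  by case: f f1 le => [|[|f]] //= _ le; rewrite !PoszD !mulrDr; lia.
case: (@hasP _ (fun p => (x == p) || (x == p.+1) || (x == p.+2)) P) => [[p Pp]|far].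
  have p4 := P_ge4 Pp.
  case/orP => [/orP[]|] /eqP Ex.
  - rewrite Ex in slack *; have [e1 e2] := counts_x ov Pp.
    apply: (slack _ 1 e1) => //; last by case: (_ == _).
    rewrite e2 /o /=; case Jp: (J p) => /=; rewrite ?eqxx /=; last by lia.
    suff : 0 < count (fun e => agent (owner e) e == p) (iota 0 n) by lia.
    have := count_first_mem Pp => c1'; apply: leq_trans (_ : _ <= count (first_mem p) (iota 0 n)) _.
      by rewrite c1'.
    apply: sub_in_count => e; rewrite mem_iota => en fe.
    have me : mem p e by case/andP: fe.
    by rewrite (@owner_uniq p e) // /agent fe.
  - rewrite Ex in slack *; have [e1 e2] := counts_y ov Pp.
    apply: (slack _ 1 e1) => //; last by case: (_ == _).
    rewrite e2 /o /=; case Jp: (J p) => /=; rewrite ?eqxx /=; last by lia.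
    suff : 2 <= count (fun e => agent (owner e) e == p.+1) (iota 0 n) by lia.
    have := count_rest_mem Pp => c2'.
    apply: leq_trans (_ : _ <= count (fun e => mem p e && ~~ first_mem p e) (iota 0 n)) _.
      by rewrite c2'.
    apply: sub_in_count => e; rewrite mem_iota => en /andP[me fe].
    by rewrite (@owner_uniq p e) // /agent (negbTE fe).
  - rewrite Ex in slack *; have [e1 e2] := counts_z ov Pp.
    apply: (slack _ 1 e1) => //; last by case: (_ == _).
    rewrite e2 /o /=; case Jp: (J p) => /=; rewrite ?eqxx /=; by lia.
rewrite (counts_other ov); first last.
- move=> p Pp; apply: contraT => H; case: far; exists p => //.
  by move: H; rewrite !negb_and !negbK orbA.
- by lia.
(* A padding candidate has net score at most 0, whereas candidate 0 has at least 2a - 2b > 0. *)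
set l := count _ _; have : (0 <= b * l%:Z)%R by apply: mulr_ge0; lia.
have : (0 <= a * (M + n)%:Z)%R by apply: mulr_ge0; lia.
by rewrite !PoszD !mulrDr; lia.
Qed.

End Weights.
End Reduction.

(** * Formulas and generators for the reduction *)

Lemma filter_iota (Q : pred nat) (l : seq nat) k : sorted ltn l ->
  (forall x : nat, x \in l -> x <= k) -> (forall x, x <= k -> Q x = (x \in l)) ->
  [seq x <- iota 0 k.+1 | Q x] = l.
Proof.
move=> sl bl Ql; apply: (irr_sorted_eq ltn_trans ltnn) => //.
  by apply: sorted_filter (iota_ltn_sorted _ _); apply: ltn_trans.
move=> x; rewrite mem_filter mem_iota /= add0n ltnS.
case: leqP => xk; first by rewrite andbT Ql.
by rewrite andbF; symmetry; apply/negP => /bl; lia.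
Qed.

Lemma out_for w env r f g (l : seq nat) : sorted ltn l ->
  (forall x : nat, x \in l -> x <= size w) ->
  (forall x, x <= size w -> sat w (upd env r x) f = (x \in l)) ->
  out w env (GFor r f g) = flatten [seq out w (upd env r x) g | x <- l].
Proof.
move=> sl bl Hf; rewrite -(filter_iota sl bl Hf).
rewrite [LHS]/(flatten _); elim: (iota 0 _) => [|x s IH] //=.
by rewrite IH; case: (sat _ _ _).
Qed.

(** A loop whose condition has a single solution acts as a local definition. *)
Lemma out_let w env r f g v : v <= size w ->
  (forall x, x <= size w -> sat w (upd env r x) f = (x == v)) ->
  out w env (GFor r f g) = out w (upd env r v) g.
Proof.
move=> vw Hf; rewrite (@out_for w env r f g [:: v]) //=; first by rewrite cats0.
- by move=> x; rewrite inE => /eqP->.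
- by move=> x xw; rewrite inE Hf.
Qed.

Lemma out_seq w env g h : out w env (GSeq g h) = out w env g ++ out w env h.
Proof. by []. Qed.

Lemma sat_exP w env r f :
  reflect (exists2 x, x <= size w & sat w (upd env r x) f) (sat w env (FEx r f)).
Proof.
apply: (iffP hasP) => [[x]|[x xw Hx]]; last by exists x; rewrite ?mem_iota.
by rewrite mem_iota /= add0n ltnS => xw Hx; exists x.
Qed.

Definition f_or f g := FNot (FAnd (FNot f) (FNot g)).

Lemma sat_and w env f g : sat w env (FAnd f g) = sat w env f && sat w env g.
Proof. by []. Qed.

Lemma sat_not w env f : sat w env (FNot f) = ~~ sat w env f.
Proof. by []. Qed.

Lemma sat_or w env f g : sat w env (f_or f g) = sat w env f || sat w env g.
Proof. by rewrite /= negb_and !negbK. Qed.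

(* Register 1 holds 0, register 2 holds 1 and register 3 holds 2. *)
Definition f_eq x y := FAdd x 1 y.
Definition f_le d x y := FEx d (FAdd x d y).
Definition f_lt d x y := FAnd (f_le d x y) (FNot (f_eq x y)).
Definition f_pow2 d r :=
  FAnd (FNot (FZero r)) (FNot (FEx d (FAnd (FDiv d r) (FAnd (FNot (f_eq d 2)) (FNot (FDiv 3 d)))))).

Lemma upd_neq env r x i : i != r -> upd env r x i = env i.
Proof. by rewrite /upd => /negbTE->. Qed.

Lemma sat_eq w env x y : env 1 = 0 -> sat w env (f_eq x y) = (env x == env y).
Proof. by move=> /= ->; rewrite addn0. Qed.

Lemma sat_le w env d x y : x != d -> y != d -> env y <= size w ->
  sat w env (f_le d x y) = (env x <= env y).
Proof.
move=> xd yd yw; apply/sat_exP/idP => [[z _]|le].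
  by rewrite /= upd_eq !upd_neq // => /eqP<-; apply: leq_addr.
exists (env y - env x); first by lia.
by rewrite /= upd_eq !upd_neq // subnKC.
Qed.

Lemma sat_lt w env d x y : x != d -> y != d -> env 1 = 0 -> env y <= size w ->
  sat w env (f_lt d x y) = (env x < env y).
Proof.
by move=> xd yd e1 yw; rewrite /f_lt sat_and sat_not sat_le // sat_eq //; lia.
Qed.

Definition is_pow2 x := x == 2 ^ logn 2 x.

Lemma is_pow2P x : reflect (exists k, x = 2 ^ k) (is_pow2 x).
Proof.
apply: (iffP eqP) => [->|[k ->]]; first by eexists.
by rewrite pfactorK.
Qed.

(** A positive number is a power of 2 iff 1 is its only odd divisor, which needs no exponentiation
    in formulas. The odd part [t] of the number is the divisor to test. *)
Lemma sat_pow2 w env d r : r != d -> d > 3 -> env 1 = 0 -> env 2 = 1 -> env 3 = 2 ->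
  env r <= size w -> sat w env (f_pow2 d r) = is_pow2 (env r).
Proof.
move=> rd d3 e1 e2 e3 rw; rewrite /f_pow2 sat_and !sat_not [sat w env (FZero r)]/=.
have nd i : i < 4 -> i != d by lia.
apply/andP/is_pow2P => [[r0 H]|[k Ek]].
  have r0' : 0 < env r by rewrite lt0n.
  have [t r2 Et] := @pfactor_coprime 2 (env r) isT r0'.
  exists (logn 2 (env r)); rewrite {1}Et.
  suff -> : t = 1 by rewrite mul1n.
  apply/eqP; apply: contraNT H => t1; apply/sat_exP; exists t.
    by apply: leq_trans rw; rewrite Et leq_pmulr // expn_gt0.
  have tr : t %| env r by rewrite Et dvdn_mulr.
  rewrite /= !upd_eq (upd_neq _ _ rd) !upd_neq ?nd // tr e1 e2 e3 addn0 t1 /=.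
  by rewrite coprime2n in r2; rewrite dvdn2 negbK.
split; first by rewrite Ek -lt0n expn_gt0.
apply/negP => /sat_exP[t _]; rewrite /= !upd_eq (upd_neq _ _ rd) !upd_neq ?nd // e1 e2 e3 addn0 Ek.
case/and3P=> /dvdn_pfactor => /(_ isT) [[|j] _ ->] //.
by rewrite expnS dvdn_mulr.
Qed.

(** 1 is the only number dividing every number in range. 2 is 1 + 1 by way of a copy of 1, because
    the operands of [FAdd] have to be distinct registers. *)
Lemma out_constants (w : seq bool) (f : gen) : 2 <= size w ->
  out w (fun=> 0) (GFor 1 (FZero 1) (GFor 2 (FNot (FEx 3 (FNot (FDiv 2 3))))
    (GFor 3 (FEx 4 (FAnd (f_eq 4 2) (FAdd 2 4 3))) f)))
  = out w (upd (upd (upd (fun=> 0) 1 0) 2 1) 3 2) f.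
Proof.
move=> w2; rewrite (@out_let _ _ _ _ _ 0) //.
rewrite (@out_let _ _ _ _ _ 1); [|by lia|]; last first.
  move=> x xw; rewrite sat_not; apply/idP/eqP => [|->].
    case: sat_exP => // nex _; apply/eqP; rewrite -dvdn1; apply: contraT => nx.
    by case: nex; exists 1; rewrite //; lia.
  by apply/negP => /sat_exP[y _] /=; rewrite dvd1n.
rewrite (@out_let _ _ _ _ _ 2) // => x xw; apply/sat_exP/eqP => [[y _]|->].
  by rewrite /f_eq /= /upd /= addn0 => /andP[/eqP-> /eqP <-].
by exists 1; rewrite //; lia.
Qed.

(** Each power of 2 up to the length of the word contributes two bits: the continuation bit of
    [enc_seq] and a digit 1. *)
Definition f_prog : gen :=
  GFor 1 (FZero 1) (GFor 2 (FNot (FEx 3 (FNot (FDiv 2 3))))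
    (GFor 3 (FEx 4 (FAnd (f_eq 4 2) (FAdd 2 4 3)))
      (GSeq (GFor 4 (f_pow2 5 4) (GSeq (GEmit true) (GEmit true))) (GEmit false)))).

(** The bit length of [s]: 2 ^ f_exp s is the least power of 2 exceeding [s]. *)
Definition f_exp (s : nat) : nat := up_log 2 s.+1.

Lemma ltn_f_exp s i : (i < f_exp s) = (2 ^ i <= s).
Proof.
rewrite ltnNge [RHS]leqNgt; congr (~~ _); apply/idP/idP => [le|]; last exact: up_log_min.
by apply: leq_trans (up_logP _ (isT : 1 < 2)) _; rewrite leq_exp2l.
Qed.

Lemma enc_nat_ones k : enc_nat (2 ^ k - 1) = flatten (nseq k [:: true; true]) ++ [:: false].
Proof.
rewrite /enc_nat /enc_seq /bits; congr (flatten _ ++ _).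
have -> : (2 ^ k - 1).+1 = 2 ^ k by rewrite subn1 prednK // expn_gt0.
rewrite up_expnK //.
suff -> : mkseq (fun i => odd ((2 ^ k - 1) %/ 2 ^ i)) k = nseq k true by rewrite map_nseq.
apply: (@eq_from_nth _ true); rewrite size_mkseq ?size_nseq // => i ik.
rewrite nth_mkseq // nth_nseq ik.
(* The low [i] digits are the remainder, so digit [i] is the parity of 2 ^ (k - i) - 1, odd because
   i < k. *)
have -> : 2 ^ k - 1 = (2 ^ (k - i) - 1) * 2 ^ i + (2 ^ i - 1).
  have := expnD 2 (k - i) i; rewrite subnK 1?ltnW // mulnBl mul1n => ->.
  have : 0 < 2 ^ i by rewrite expn_gt0.
  have : 2 ^ i <= 2 ^ (k - i) * 2 ^ i by rewrite leq_pmull // expn_gt0.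
  by lia.
rewrite divnMDl ?expn_gt0 // divn_small ?addn0; last by have := expn_gt0 2 i; lia.
by rewrite oddB ?expn_gt0 // oddX /= orbF subn_eq0 leqNgt ik.
Qed.

Lemma out_f_prog w : 2 <= size w -> out w (fun=> 0) f_prog = enc_nat (2 ^ f_exp (size w) - 1).
Proof.
move=> w2; rewrite /f_prog out_constants // out_seq.
rewrite (@out_for _ _ _ _ _ [seq 2 ^ i | i <- iota 0 (f_exp (size w))]).
- rewrite enc_nat_ones; congr (flatten _ ++ _); rewrite -map_comp.
  by rewrite -[in RHS](size_iota 0 (f_exp _)); elim: (iota _ _) => //= i s ->.
- rewrite sorted_map; apply: sub_sorted (iota_ltn_sorted _ _) => i j /=.
  by rewrite ltn_exp2l.
- by move=> x /mapP[i]; rewrite mem_iota /= add0n ltn_f_exp => le ->.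
- move=> x xw; rewrite sat_pow2 //; apply/is_pow2P/mapP => [[k Ek]|[k _ ->]]; last by exists k.
  by exists k => //; rewrite mem_iota /= add0n ltn_f_exp -Ek.
Qed.

(** The characteristic vector of a set starts right behind its tag bit at [p], whence the offset
    1. *)
Definition bit_mem (w : seq bool) (p e : nat) : bool := onth w (p + e.+1) == Some true.

Definition f_set d r := FAnd (FDiv 6 r) (FAnd (FNot (FZero r)) (f_lt d r 7)).
Definition f_mem d p e :=
  FEx d (FAnd (FAdd p e d) (FEx d.+1 (FAnd (FAdd d 2 d.+1) (FIn true d.+1)))).
Definition f_first d p e :=
  FAnd (f_mem d p e) (FNot (FEx d (FAnd (f_lt d.+1 d e) (f_mem d.+1 p d)))).
Definition f_user d e x :=
  FEx d (FAnd (f_set d.+1 d) (FAnd (f_mem d.+1 d e)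
    (f_or (FAnd (f_first d.+1 d e) (f_eq x d))
          (FAnd (FNot (f_first d.+1 d e)) (FAdd d 2 x))))).

(* Registers: 4 holds 3, 5 holds n, 6 holds n + 1, 7 is the position of the last
   bit of the X3C instance, 8 is the number of candidates minus one; 9, 10, 11
   and 12 are the set, the copy, and the two candidates that are compared. *)
Definition f_top kd x :=
  nth (FZero x) [:: FZero x; f_eq x 3; f_eq x 2; FAdd 9 3 x; FZero x; f_eq x 3;
    f_eq x 9; FAdd 9 2 x; FAdd 9 3 x; FZero x; f_eq x 2; f_eq x 2] kd.
Definition f_bot kd x :=
  nth (f_eq x 3) [:: f_eq x 2; FZero x; f_eq x 3; f_eq x 3;
    f_or (f_eq x 9) (f_or (FAdd 9 3 x) (f_eq x 3)); FAdd 9 3 x;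
    f_eq x 3; f_eq x 3; f_eq x 3; f_or (f_eq x 3) (f_user 13 10 x); f_eq x 3; f_eq x 3] kd.
Definition f_iso kd x :=
  let no := FAnd (FZero x) (FNot (FZero x)) in
  nth no [:: no; no; f_eq x 9; FAdd 9 2 x] kd.
Definition f_rel kd :=
  FAnd (FNot (f_iso kd 11)) (FAnd (FNot (f_iso kd 12)) (FAnd (FNot (f_top kd 12))
    (f_or (f_top kd 11) (FAnd (FNot (f_bot kd 11)) (f_bot kd 12))))).
Definition f_rng1 kd :=
  if kd \in [:: 0; 1; 9; 10; 11] then FZero 9 else f_set 10 9.
Definition f_rng2 kd :=
  nth (FZero 10) [:: f_le 11 10 2; f_le 11 10 2; FZero 10; FZero 10; FZero 10; FZero 10;
    f_or (f_le 11 10 5) (f_set 11 10); f_or (f_le 11 10 5) (f_set 11 10);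
    f_or (f_le 11 10 5) (f_set 11 10); f_lt 11 10 5; f_le 11 10 6;
    FAnd (FDiv 4 10) (f_lt 11 10 5)] kd.

Definition g_block kd :=
  GFor 9 (f_rng1 kd) (GFor 10 (f_rng2 kd) (GSeq (GEmit true)
    (GFor 11 (f_le 12 11 8) (GFor 12 (f_le 13 12 8) (GBit (f_rel kd)))))).

(** The innermost [GEmit false] ends the list of votes; the final one is the unary code of the
    distinguished candidate 0. *)
Definition g_body : gen :=
  GSeq (GSeq (GFor 9 (f_le 10 9 8) (GEmit true)) (GEmit false))
       (GSeq (foldr (fun kd g => GSeq (g_block kd) g) (GEmit false) (iota 0 12))
             (GEmit false)).

(** A false bit where a tag is expected announces that no further set follows. *)
Definition f_end r := FAnd (FIn false r) (FAnd (FDiv 6 r) (FNot (FZero r))).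
Definition f_big d r := FEx d (FAnd (FAdd 7 2 d) (f_lt d.+1 d r)).

(** Each outer loop binds one register to one value. The delimiters in registers 5 and 7 and the
    power of 2 in register 8 are the least solutions of conditions that larger numbers may satisfy
    too. *)
Definition g_prog : gen :=
  GFor 1 (FZero 1) (GFor 2 (FNot (FEx 3 (FNot (FDiv 2 3))))
  (GFor 3 (FEx 4 (FAnd (f_eq 4 2) (FAdd 2 4 3)))
  (GFor 4 (FAdd 2 3 4)
  (GFor 5 (FAnd (FIn false 5) (FNot (FEx 6 (FAnd (f_lt 7 6 5) (FIn false 6)))))
  (GFor 6 (FAdd 5 2 6)
  (GFor 7 (FAnd (f_end 7) (FNot (FEx 8 (FAnd (f_lt 9 8 7) (f_end 8)))))
  (GFor 8 (FAnd (FAnd (f_pow2 9 8) (f_big 9 8))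
             (FNot (FEx 9 (FAnd (f_lt 10 9 8) (FAnd (f_pow2 10 9) (f_big 10 9))))))
   g_body))))))).

(** * Meaning of the formulas on a word of the expected shape *)

Section Program.
Variables (w : seq bool) (n M : nat).
Notation last_pos := (n.+1 * M.+1).
Notation r0 := (2 ^ f_exp last_pos.+1).
Hypothesis w_pre : forall i, i < n -> onth w i = Some true.
Hypothesis w_n : onth w n = Some false.
Hypothesis w_set : forall j, j < M -> onth w (n.+1 * j.+1) = Some true.
Hypothesis w_last : onth w last_pos = Some false.
Hypothesis w_size : r0 < size w.

Definition set_positions : seq nat := [seq n.+1 * j.+1 | j <- iota 0 M].
Notation P := set_positions.

Lemma last_pos_lt : last_pos < size w.
Proof. by rewrite -onthTE w_last. Qed.

Lemma r0_gt : last_pos.+1 < r0.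
Proof. by rewrite ltnNge -ltn_f_exp ltnn. Qed.

Lemma mem_positions x : (x \in P) = [&& n.+1 %| x, x != 0 & x < last_pos].
Proof.
apply/mapP/and3P => [[j]|[/dvdnP[j Ex] x0 xl]].
  by rewrite mem_iota /= add0n => jM ->; rewrite dvdn_mulr ?ltn_pmul2l.
exists j.-1; last by case: j Ex x0 {xl} => [->|j ->] //; rewrite mulnC.
rewrite mem_iota /= add0n; rewrite Ex mulnC ltn_pmul2l // in xl.
by case: j Ex x0 xl => [->|j].
Qed.

(** What the outer loops of [g_prog] establish; the registers from 9 on remain free. *)
Definition good (env : nat -> nat) : Prop :=
  [/\ [/\ env 1 = 0, env 2 = 1, env 3 = 2 & env 4 = 3],
      [/\ env 5 = n, env 6 = n.+1, env 7 = last_pos & env 8 = r0]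
    & forall i, env i <= size w].

Lemma good_upd env r x : good env -> 8 < r -> x <= size w -> good (upd env r x).
Proof.
move=> [[e1 e2 e3 e4] [e5 e6 e7 e8] bnd] r8 xw.
split; [split|split|by apply: bounded_upd]; rewrite upd_neq //; lia.
Qed.

Lemma sat_set env d r : good env -> 8 < r < d ->
  sat w env (f_set d r) = (env r \in P).
Proof.
move=> [[e1 _ _ _] [_ e6 e7 _] bnd] rd.
have -> : sat w env (f_set d r) =
  [&& env 6 %| env r, env r != 0 & sat w env (f_lt d r 7)] by [].
by rewrite mem_positions sat_lt ?e6 ?e7 ?(ltnW last_pos_lt) //; lia.
Qed.

Lemma sat_bit_mem env d p e : good env -> 8 < d -> p < d -> e < d ->
  sat w env (f_mem d p e) = bit_mem w (env p) (env e).
Proof.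
move=> ge d8 pd ed; have e2 : env 2 = 1 by case: ge => [[]].
have ep x : upd env d x p = env p by rewrite upd_neq; lia.
have ee x : upd env d x e = env e by rewrite upd_neq; lia.
have ed1 x y : upd (upd env d x) d.+1 y d = x by rewrite upd_neq ?upd_eq; lia.
have ed2 x y : upd (upd env d x) d.+1 y 2 = 1 by rewrite !upd_neq //; lia.
apply/sat_exP/eqP => [[x xw]|H].
  rewrite sat_and => /andP[Ex /sat_exP[y yw]]; move: Ex => /=.
  rewrite !upd_eq ep ee ed1 ed2 => /eqP <- /andP[/eqP <- /eqP <-].
  by congr onth; lia.
have sz : env p + (env e).+1 < size w by rewrite -onthTE H.
exists (env p + env e); first by lia.
rewrite sat_and; apply/andP; split; first by rewrite /= upd_eq ep ee.
apply/sat_exP; exists (env p + (env e).+1); first by lia.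
by rewrite /= !upd_eq ed1 ed2 H addn1 addnS !eqxx.
Qed.

Lemma sat_first env d p e : good env -> 8 < d -> p < d -> e < d ->
  sat w env (f_first d p e) = first_mem (bit_mem w) (env p) (env e).
Proof.
move=> ge d8 pd ed; rewrite /f_first sat_and sat_not sat_bit_mem // /first_mem.
have bnd i : env i <= size w by case: ge.
have lt_mem x : x <= size w -> sat w (upd env d x) (FAnd (f_lt d.+1 d e) (f_mem d.+1 p d))
    = (x < env e) && bit_mem w (env p) x.
  move=> xw; have gx := good_upd ge d8 xw.
  have e1 : upd env d x 1 = 0 by case: gx => [[]].
  have ep : upd env d x p = env p by rewrite upd_neq; lia.
  have ee : upd env d x e = env e by rewrite upd_neq; lia.
  rewrite sat_and (@sat_lt _ _ d.+1 d e); [|lia|lia|by []|by rewrite ee].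
  by rewrite sat_bit_mem ?upd_eq ?ep ?ee //; lia.
congr (_ && ~~ _); apply/sat_exP/hasP => [[x xw]|[x]].
  by rewrite lt_mem // => /andP[xe mx]; exists x; rewrite // mem_iota.
rewrite mem_iota add0n => /andP[_ xe] mx; have xw : x <= size w by have := bnd e; lia.
by exists x => //; rewrite lt_mem // xe.
Qed.

Lemma sat_user env d e x : good env -> 8 < d -> e < d -> x < d -> x != 1 ->
  sat w env (f_user d e x) = user P (bit_mem w) (env e) (env x).
Proof.
move=> ge d8 ed xd x1; have bnd i : env i <= size w by case: ge.
have body p : p <= size w -> sat w (upd env d p) (FAnd (f_set d.+1 d) (FAnd (f_mem d.+1 d e)
    (f_or (FAnd (f_first d.+1 d e) (f_eq x d))
          (FAnd (FNot (f_first d.+1 d e)) (FAdd d 2 x))))) =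
    (p \in P) && (bit_mem w p (env e) && (env x == agent (bit_mem w) p (env e))).
  move=> pw; have gp := good_upd ge d8 pw.
  have [e1 e2] : upd env d p 1 = 0 /\ upd env d p 2 = 1 by case: gp => [[]].
  set env' := upd env d p in gp e1 e2 *.
  have -> : sat w env' (FAnd (f_set d.+1 d) (FAnd (f_mem d.+1 d e)
    (f_or (FAnd (f_first d.+1 d e) (f_eq x d))
          (FAnd (FNot (f_first d.+1 d e)) (FAdd d 2 x))))) =
    sat w env' (f_set d.+1 d) && (sat w env' (f_mem d.+1 d e) &&
      ~~ (~~ (sat w env' (f_first d.+1 d e) && sat w env' (f_eq x d)) &&
          ~~ (~~ sat w env' (f_first d.+1 d e) && (env' d + env' 2 == env' x)))) by [].
  rewrite sat_set ?sat_bit_mem ?sat_first ?sat_eq //; try lia.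
  have -> : env' d = p by rewrite /env' upd_eq.
  have -> : env' e = env e by rewrite /env' upd_neq; lia.
  have -> : env' x = env x by rewrite /env' upd_neq; lia.
  congr (_ && (_ && _)); rewrite /agent e2 addn1.
  by case: first_mem; rewrite /= ?andbT ?negbK // eq_sym.
apply/sat_exP/hasP => [[p pw]|[p Pp H]].
  by rewrite body // => /andP[Pp H]; exists p.
have pw : p <= size w by move: Pp; rewrite mem_positions; have := last_pos_lt; lia.
by exists p => //; rewrite body // Pp.
Qed.

Ltac each_kind kd := have : kd \in iota 0 12 by rewrite mem_iota.
Ltac split_kinds := rewrite [iota 0 12]/= !inE; repeat case/orP; move/eqP->.

Section Vote.
Variables (kd : nat) (env : nat -> nat).
Hypotheses (k12 : kd < 12) (ge : good env).

Lemma sat_top x : sat w env (f_top kd x) = (env x == top_of kd (env 9)).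
Proof.
case: ge => [[e1 e2 e3 e4] [e5 e6 e7 e8] bnd]; rewrite /f_top /top_of.
each_kind kd; split_kinds.
all: by rewrite /= ?e1 ?e2 ?e3 ?addn0 ?addn1 ?addn2 // eq_sym.
Qed.

Lemma sat_bot x : 8 < x < 13 ->
  sat w env (f_bot kd x) = bot_of P (bit_mem w) kd (env 9) (env 10) (env x).
Proof.
move=> xd; have us := @sat_user env 13 10 x ge isT isT ltac:(lia) ltac:(lia).
case: ge => [[e1 e2 e3 e4] [e5 e6 e7 e8] bnd].
have [->|n9] := eqVneq kd 9.
  have -> : sat w env (f_bot 9 x) =
    ~~ (~~ sat w env (f_eq x 3) && ~~ sat w env (f_user 13 10 x)) by [].
  by rewrite us sat_eq // e3 negb_and !negbK.
move: n9; each_kind kd; split_kinds => //.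
all: by rewrite /f_bot /bot_of /= ?inE ?negb_and ?negbK ?e1 ?e2 ?e3 ?addn0 //; lia.
Qed.

Lemma sat_iso x : sat w env (f_iso kd x) = iso_of kd (env 9) (env x).
Proof.
case: ge => [[e1 e2 e3 e4] [e5 e6 e7 e8] bnd].
each_kind kd; split_kinds.
all: by rewrite /f_iso /iso_of /= ?andbN ?e1 ?e2 ?addn0 ?addn1 // eq_sym.
Qed.

Definition nat_rel (v : level_vote) (x y : nat) : bool :=
  [&& ~~ isos v x, ~~ isos v y & level v x < level v y].

Lemma sat_rel : sat w env (f_rel kd) =
  nat_rel (vote_idx P (bit_mem w) (kd, env 9, env 10)) (env 11) (env 12).
Proof.
have -> : sat w env (f_rel kd) =
  [&& ~~ sat w env (f_iso kd 11), ~~ sat w env (f_iso kd 12), ~~ sat w env (f_top kd 12)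
    & ~~ (~~ sat w env (f_top kd 11) && ~~ (~~ sat w env (f_bot kd 11) && sat w env (f_bot kd 12)))]
  by [].
rewrite !sat_top !sat_bot // !sat_iso /nat_rel /level /vote_idx /=.
congr (_ && (_ && _)).
by case: (env 11 == _); case: (env 12 == _); case: bot_of; case: bot_of.
Qed.

End Vote.

Lemma sorted_positions : sorted ltn P.
Proof.
rewrite sorted_map; apply: sub_sorted (iota_ltn_sorted _ _) => i j /=.
by rewrite ltn_pmul2l.
Qed.

Lemma positions_gt p : p \in P -> n < p.
Proof.
rewrite mem_positions => /and3P[d p0 _]; apply: dvdn_leq d; by rewrite lt0n.
Qed.

Lemma positions_lt p : p \in P -> p < last_pos.
Proof. by rewrite mem_positions => /and3P[]. Qed.

Lemma sorted_copies : sorted ltn (iota 0 n.+1 ++ P).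
Proof.
rewrite (sorted_pairwise ltn_trans) pairwise_cat -!(sorted_pairwise ltn_trans).
rewrite iota_ltn_sorted sorted_positions !andbT; apply/allrelP => x y.
by rewrite mem_iota => xn /positions_gt; lia.
Qed.

(** Loops enumerate in increasing order, so producing the votes in the order of [indices] requires
    sorted ranges. *)
Lemma rng1P env kd : kd < 12 -> good env ->
  [/\ sorted ltn (rng n P kd).1, forall x : nat, x \in (rng n P kd).1 -> x <= size w
    & forall x, x <= size w -> sat w (upd env 9 x) (f_rng1 kd) = (x \in (rng n P kd).1)].
Proof.
move=> k12 ge; have lp := last_pos_lt.
have HP : [/\ sorted ltn P, forall x : nat, x \in P -> x <= size w
    & forall x, x <= size w -> sat w (upd env 9 x) (f_set 10 9) = (x \in P)].
  split=> [|x /positions_lt|x xw]; [exact: sorted_positions|lia|].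
  by rewrite sat_set //; apply: good_upd.
have H1 : [/\ sorted ltn [:: 0], forall x : nat, x \in [:: 0] -> x <= size w
    & forall x, x <= size w -> sat w (upd env 9 x) (FZero 9) = (x \in [:: 0])].
  by split=> // x; rewrite !inE // => /eqP->.
by each_kind kd; split_kinds.
Qed.

Lemma rng2P env kd : kd < 12 -> good env ->
  [/\ sorted ltn (rng n P kd).2, forall x : nat, x \in (rng n P kd).2 -> x <= size w
    & forall x, x <= size w -> sat w (upd env 10 x) (f_rng2 kd) = (x \in (rng n P kd).2)].
Proof.
move=> k12 ge; have lp := last_pos_lt; have rg := r0_gt; have rw := w_size.
have nl : n < last_pos by rewrite leq_pmulr.
have gu x : x <= size w -> good (upd env 10 x) by move=> xw; apply: good_upd.
have le y v x : y != 10 -> env y = v -> y != 11 -> v <= size w -> x <= size w ->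
    sat w (upd env 10 x) (f_le 11 10 y) = (x <= v).
  by move=> y10 ey y11 vw xw; rewrite sat_le ?upd_eq ?(upd_neq _ _ y10) ?ey.
have lt y v x : y != 10 -> env y = v -> y != 11 -> v <= size w -> x <= size w ->
    sat w (upd env 10 x) (f_lt 11 10 y) = (x < v).
  move=> y10 ey y11 vw xw; have e1 : upd env 10 x 1 = 0 by case: (gu x xw) => [[]].
  by rewrite sat_lt ?upd_eq ?(upd_neq _ _ y10) ?ey.
have [[e1 e2 e3 e4] [e5 e6 e7 e8] bnd] := ge.
have H0 : [/\ sorted ltn [:: 0], forall x : nat, x \in [:: 0] -> x <= size w
    & forall x, x <= size w -> sat w (upd env 10 x) (FZero 10) = (x \in [:: 0])].
  by split=> // x; rewrite !inE // => /eqP->.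
have H1 : [/\ sorted ltn [:: 0; 1], forall x : nat, x \in [:: 0; 1] -> x <= size w
    & forall x, x <= size w -> sat w (upd env 10 x) (f_le 11 10 2) = (x \in [:: 0; 1])].
  split=> // x; rewrite !inE; first by lia.
  by move=> xw; rewrite (le 2 1) //; lia.
have H2 : [/\ sorted ltn (iota 0 n.+1 ++ P),
      forall x : nat, x \in iota 0 n.+1 ++ P -> x <= size w
    & forall x, x <= size w -> sat w (upd env 10 x) (f_or (f_le 11 10 5) (f_set 11 10))
                             = (x \in iota 0 n.+1 ++ P)].
  split=> [|x|x xw]; first exact: sorted_copies.
    by rewrite mem_cat mem_iota => /orP[|/positions_lt]; lia.
  rewrite sat_or (le 5 n) ?sat_set ?upd_eq //; [|by apply: gu|by lia].
  by rewrite mem_cat mem_iota.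
have H3 : [/\ sorted ltn (iota 0 n), forall x : nat, x \in iota 0 n -> x <= size w
    & forall x, x <= size w -> sat w (upd env 10 x) (f_lt 11 10 5) = (x \in iota 0 n)].
  split=> [|x|x xw]; first exact: iota_ltn_sorted.
    by rewrite mem_iota; lia.
  by rewrite (lt 5 n) ?mem_iota //; lia.
have H4 : [/\ sorted ltn (iota 0 n.+2), forall x : nat, x \in iota 0 n.+2 -> x <= size w
    & forall x, x <= size w -> sat w (upd env 10 x) (f_le 11 10 6) = (x \in iota 0 n.+2)].
  split=> [|x|x xw]; first exact: iota_ltn_sorted.
    by rewrite mem_iota; lia.
  by rewrite (le 6 n.+1) ?mem_iota //; lia.
have H5 : [/\ sorted ltn [seq i <- iota 0 n | 3 %| i],
      forall x : nat, x \in [seq i <- iota 0 n | 3 %| i] -> x <= size w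
    & forall x, x <= size w -> sat w (upd env 10 x) (FAnd (FDiv 4 10) (f_lt 11 10 5))
                             = (x \in [seq i <- iota 0 n | 3 %| i])].
  split=> [|x|x xw].
  - by apply: sorted_filter (iota_ltn_sorted _ _); apply: ltn_trans.
  - by rewrite mem_filter mem_iota; lia.
  rewrite sat_and (lt 5 n) ?mem_filter ?mem_iota //; last by lia.
  by rewrite /= upd_eq upd_neq // e4.
by each_kind kd; split_kinds.
Qed.

Notation m := r0.+1.
Definition matrix_word (v : level_vote) : seq bool :=
  [seq nat_rel v x y | x <- iota 0 m, y <- iota 0 m].

Lemma flatten_seq1 (T U : Type) (F : T -> U) s : flatten [seq [:: F x] | x <- s] = map F s.
Proof. by elim: s => //= x s ->. Qed.

Lemma iota_le k x : (x \in iota 0 k.+1) = (x <= k).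
Proof. by rewrite mem_iota. Qed.

Lemma out_upto env d f g : good env -> 8 < d ->
  f = f_le d.+1 d 8 ->
  out w env (GFor d f g) = flatten [seq out w (upd env d x) g | x <- iota 0 m].
Proof.
move=> ge d8 ->; have rw := w_size; apply: out_for => [|x|x xw]; first exact: iota_ltn_sorted.
  by rewrite iota_le; lia.
have e8 : upd env d x 8 = r0 by rewrite upd_neq; [case: ge => [_ []] | lia].
by rewrite sat_le ?iota_le ?e8 ?upd_eq //; lia.
Qed.

Lemma out_matrix env kd : kd < 12 -> good env ->
  out w env (GFor 11 (f_le 12 11 8) (GFor 12 (f_le 13 12 8) (GBit (f_rel kd)))) =
  matrix_word (vote_idx P (bit_mem w) (kd, env 9, env 10)).
Proof.
move=> k12 ge; have rw := w_size; rewrite (@out_upto env 11) //; congr flatten.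
apply/eq_in_map => x; rewrite iota_le => xr.
have g1 : good (upd env 11 x) by apply: good_upd => //; lia.
rewrite (@out_upto _ 12) // -[RHS]flatten_seq1; congr flatten.
apply/eq_in_map => y; rewrite iota_le => yr; congr cons.
by rewrite sat_rel //; apply: good_upd => //; lia.
Qed.

Lemma flatten_map_allpairs (T U V W : Type) (F : T -> U -> V) (G : V -> seq W) s t :
  flatten [seq G z | z <- [seq F x y | x <- s, y <- t]] =
  flatten [seq flatten [seq G (F x y) | y <- t] | x <- s].
Proof. by elim: s => //= x s IH; rewrite map_cat flatten_cat IH -map_comp. Qed.

Lemma out_block env kd : kd < 12 -> good env ->
  out w env (g_block kd) =
  flatten [seq true :: matrix_word (vote_idx P (bit_mem w) t) | t <- block n P kd].
Proof.
move=> k12 ge; have [s1 b1 sat1] := rng1P k12 ge; rewrite /g_block (out_for _ s1 b1 sat1).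
rewrite /block flatten_map_allpairs; congr flatten; apply/eq_in_map => p /b1 pw.
have g1 : good (upd env 9 p) by apply: good_upd.
have [s2 b2 sat2] := rng2P k12 g1; rewrite (out_for _ s2 b2 sat2).
congr flatten; apply/eq_in_map => i /b2 iw; rewrite out_seq; congr cons.
by rewrite out_matrix //; apply: good_upd.
Qed.

Lemma out_blocks env s : all (fun kd => kd < 12) s -> good env ->
  out w env (foldr (fun kd g => GSeq (g_block kd) g) (GEmit false) s) =
  flatten [seq true :: matrix_word (vote_idx P (bit_mem w) t)
          | t <- flatten [seq block n P kd | kd <- s]] ++ [:: false].
Proof.
move=> + ge; elim: s => // kd s IH /andP[k12 /IH E].
have -> : foldr (fun kd g => GSeq (g_block kd) g) (GEmit false) (kd :: s) =
  GSeq (g_block kd) (foldr (fun kd g => GSeq (g_block kd) g) (GEmit false) s) by [].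
by rewrite out_seq out_block // E catA -flatten_cat -map_cat.
Qed.

Lemma out_body env : good env ->
  out w env g_body = enc_unary m ++
    (flatten [seq true :: matrix_word (vote_idx P (bit_mem w) t) | t <- indices n P]
     ++ [:: false]) ++ [:: false].
Proof.
move=> ge; rewrite /g_body out_seq out_seq out_seq out_blocks //; congr (_ ++ _).
rewrite (@out_upto _ 9) // /enc_unary -cats1; congr (_ ++ _).
by rewrite -[X in nseq X _](size_iota 0); elim: (iota 0 m) => //= x s ->.
Qed.

Lemma sat_f_big env d r : r < d -> 7 < d -> env 1 = 0 -> env 2 = 1 -> env 7 = last_pos ->
  env r <= size w -> sat w env (f_big d r) = (last_pos.+1 < env r).
Proof.
move=> rd d7 e1 e2 e7 rw.
have er x : upd env d x r = env r by rewrite upd_neq; lia.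
have e1' x : upd env d x 1 = 0 by rewrite upd_neq; lia.
have e2' x : upd env d x 2 = 1 by rewrite upd_neq; lia.
have e7' x : upd env d x 7 = last_pos by rewrite upd_neq; lia.
have body x : sat w (upd env d x) (FAnd (FAdd 7 2 d) (f_lt d.+1 d r)) =
    (last_pos.+1 == x) && (x < env r).
  rewrite sat_and (@sat_lt _ _ d.+1 d r) ?er //; try lia.
  by rewrite [sat _ _ _]/= e7' e2' upd_eq addn1.
apply/sat_exP/idP => [[x _]|lt]; first by rewrite body => /andP[/eqP->].
by exists last_pos.+1; rewrite ?body ?eqxx //; have := last_pos_lt; lia.
Qed.

Lemma sat_least env r A B (Q : pred nat) x : x <= size w -> env 1 = 0 -> 1 < r ->
  sat w (upd env r x) A = Q x ->
  (forall y, y <= size w -> sat w (upd (upd env r x) r.+1 y) B = Q y) ->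
  sat w (upd env r x) (FAnd A (FNot (FEx r.+1 (FAnd (f_lt r.+2 r.+1 r) B)))) =
  Q x && ~~ has Q (iota 0 x).
Proof.
move=> xw e1 r1 HA HB; rewrite sat_and sat_not HA; congr (_ && ~~ _).
have body y : y <= size w -> sat w (upd (upd env r x) r.+1 y) (FAnd (f_lt r.+2 r.+1 r) B) =
    (y < x) && Q y.
  have er : upd (upd env r x) r.+1 y r = x by rewrite upd_neq ?upd_eq; lia.
  have e1' : upd (upd env r x) r.+1 y 1 = 0 by rewrite !upd_neq; lia.
  by move=> yw; rewrite sat_and HB // (@sat_lt _ _ r.+2 r.+1 r) ?er ?upd_eq //; lia.
apply/sat_exP/hasP => [[y yw]|[y]].
  by rewrite body // => /andP[yx Qy]; exists y; rewrite // mem_iota.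
rewrite mem_iota add0n => /andP[_ yx] Qy; have yw : y <= size w by lia.
by exists y => //; rewrite body // yx.
Qed.

Lemma leastE (Q : pred nat) v x : Q v -> (forall y, y < v -> ~~ Q y) ->
  Q x && ~~ has Q (iota 0 x) = (x == v).
Proof.
move=> Qv lt; case: (ltngtP x v) => [/lt/negbTE-> //|vx|->].
  by apply/negP => /andP[_ /hasP[]]; exists v; rewrite // mem_iota.
by rewrite Qv; apply/hasPn => y; rewrite mem_iota add0n => /lt.
Qed.

Lemma out_g_prog : out w (fun=> 0) g_prog = enc_unary m ++
    (flatten [seq true :: matrix_word (vote_idx P (bit_mem w) t) | t <- indices n P]
     ++ [:: false]) ++ [:: false].
Proof.
have lp := last_pos_lt; have rg := r0_gt; have rw := w_size.
have nl : n < last_pos by rewrite leq_pmulr.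
rewrite /g_prog out_constants; last by lia.
rewrite (@out_let _ _ _ _ _ 3); [|lia|by move=> x xw; rewrite eq_sym].
rewrite (@out_let _ _ _ _ _ n); [|lia|]; last first.
  move=> x xw; rewrite (@sat_least _ 5 _ _ (fun y => onth w y == Some false)) //.
  by apply: leastE => [|y yn]; rewrite ?w_n ?w_pre.
rewrite (@out_let _ _ _ _ _ n.+1); [|lia|by move=> x xw; rewrite eq_sym /= /upd /= addn1].
rewrite (@out_let _ _ _ _ _ last_pos); [|lia|]; last first.
  move=> x xw.
  rewrite (@sat_least _ 7 _ _ (fun y => [&& onth w y == Some false, n.+1 %| y & y != 0])) //.
  apply: leastE => [|y yl]; first by rewrite w_last dvdn_mulr.
  (* Before the terminator, a nonzero multiple of n + 1 is a set position, where the tag is true. *)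
  apply/negP => /and3P[/eqP Ey dy y0].
  have : y \in P by rewrite mem_positions dy y0.
  by case/mapP=> j; rewrite mem_iota add0n => /andP[_ jM] Ej; rewrite Ej w_set in Ey.
rewrite (@out_let _ _ _ _ _ r0); [|lia|]; last first.
  move=> x xw; rewrite (@sat_least _ 8 _ _ (fun y => is_pow2 y && (last_pos.+1 < y))) //.
  - apply: leastE => [|y yr]; first by rewrite rg andbT; apply/is_pow2P; eexists.
    apply/negP => /andP[/is_pow2P[i Ei]]; rewrite Ei ltnNge -ltn_f_exp.
    by move: yr; rewrite Ei ltn_exp2l // => ->.
  - by rewrite sat_and sat_pow2 ?sat_f_big.
  - by move=> y yw; rewrite sat_and sat_pow2 ?sat_f_big.
apply: out_body; split; [by []|by []|].
do 8!(apply: bounded_upd; last by lia); by [].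
Qed.

End Program.

(** * Words encoding X3C instances *)

Lemma onth_flatten_const (T : Type) (bs : seq (seq T)) s r j i :
  all (fun b => size b == s) bs -> j < size bs -> i < s ->
  onth (flatten bs ++ r) (s * j + i) = onth (nth [::] bs j) i.
Proof.
elim: bs j => // b bs IH [|j] /= /andP[/eqP sb sbs] jb is_.
  by rewrite muln0 add0n -catA onth_cat sb is_.
rewrite -catA onth_cat sb mulnS -addnA ltnNge leq_addr /= addKn.
exact: IH.
Qed.

Lemma size_flatten_const (T : Type) (bs : seq (seq T)) s :
  all (fun b => size b == s) bs -> size (flatten bs) = s * size bs.
Proof.
by elim: bs => [|b bs IH] /=; rewrite ?muln0 // => /andP[/eqP sb /IH E]; rewrite size_cat E sb mulnS.
Qed.

Section Instance.
Variables (I : x3c) (rest : seq bool).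
Notation n := (x3c_n I).
Notation sets := (x3c_sets I).
Notation M := (size sets).
Notation w := (enc_x3c I ++ rest).
Notation P := (set_positions n M).
Let char_word (A : {set 'I_n}) := [seq e \in A | e <- enum 'I_n].
Let chunks := enc_unary n :: [seq true :: char_word A | A <- sets].

(** The unary header and every tagged set have the same length n + 1, so the word is a table whose
    entries are addressed by multiplication. *)
Lemma enc_x3c_chunks : enc_x3c I = flatten chunks ++ [:: false].
Proof. by rewrite /enc_x3c /enc_seq /chunks /= catA. Qed.

Lemma size_chunks : all (fun b => size b == n.+1) chunks.
Proof.
rewrite /= /enc_unary size_rcons size_nseq eqxx /=.
by apply/allP => b /mapP[A _ ->]; rewrite /= size_map size_enum_ord.
Qed.

Lemma size_enc_x3c : size (enc_x3c I) = (n.+1 * M.+1).+1.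
Proof.
by rewrite enc_x3c_chunks size_cat (size_flatten_const size_chunks) /= size_map addn1.
Qed.

Lemma onth_chunk j i : j <= M -> i <= n -> onth w (n.+1 * j + i) = onth (nth [::] chunks j) i.
Proof.
move=> jM iN; rewrite enc_x3c_chunks -catA onth_flatten_const ?size_chunks //.
by rewrite /= size_map ltnS.
Qed.

Lemma onth_enc_pre i : i < n -> onth w i = Some true.
Proof.
move=> iN; have := @onth_chunk 0 i isT (ltnW iN); rewrite muln0 add0n => ->.
by rewrite /= /enc_unary -cats1 onth_cat size_nseq iN onth_nseq iN.
Qed.

Lemma onth_enc_n : onth w n = Some false.
Proof.
have := @onth_chunk 0 n isT (leqnn n); rewrite muln0 add0n => ->.
by rewrite /= /enc_unary -cats1 onth_cat size_nseq ltnn subnn.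
Qed.

Lemma onth_enc_set j : j < M -> onth w (n.+1 * j.+1) = Some true.
Proof.
move=> jM; have := @onth_chunk j.+1 0 jM isT; rewrite addn0 => ->.
by rewrite /= (nth_map set0).
Qed.

Lemma onth_enc_last : onth w (n.+1 * M.+1) = Some false.
Proof.
rewrite enc_x3c_chunks -catA onth_cat (size_flatten_const size_chunks) /= size_map.
by rewrite ltnn subnn.
Qed.

Lemma bit_mem_enc j (e : 'I_n) : j < M ->
  bit_mem w (n.+1 * j.+1) e = (e \in nth set0 sets j).
Proof.
move=> jM; rewrite /bit_mem (@onth_chunk j.+1 e.+1 jM (ltn_ord e)).
rewrite [nth _ _ _]/= (nth_map set0) // [onth _ _]/=.
rewrite onth_map; have -> : onth (enum 'I_n) e = Some e.
  by rewrite onthE (nth_map e) ?size_enum_ord // nth_ord_enum.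
by rewrite /=; case: (e \in nth set0 sets j).
Qed.

Lemma card_set j : j < M -> #|nth set0 sets j| = 3.
Proof. by move=> jM; apply/eqP; apply: (allP (x3c_card3 I)); apply: mem_nth. Qed.

Lemma positionsP (p : nat) : reflect (exists2 j, j < M & p = n.+1 * j.+1) (p \in P).
Proof.
apply: (iffP mapP) => [[j]|[j jM ->]]; last by exists j; rewrite // mem_iota.
by rewrite mem_iota add0n => /andP[_ jM] ->; exists j.
Qed.

(** This makes the distance n + 1 between set positions at least 4. *)
Lemma n_ge3 : 0 < M -> 3 <= n.
Proof. by move/card_set => <-; rewrite -[X in _ <= X]card_ord; apply: max_card. Qed.

Lemma count_bit_mem (p : nat) : p \in P -> count (bit_mem w p) (iota 0 n) = 3.
Proof.
case/positionsP => j jM ->; rewrite -(card_set jM) -val_enum_ord count_map.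
rewrite (eq_count (a2 := mem (nth set0 sets j))); last by move=> e /=; rewrite bit_mem_enc.
by rewrite -size_filter cardE enumT.
Qed.

(** Predicates on positions correspond to masks of the list of sets, which also treats repeated sets
    as distinct. *)
Lemma count_cover (J : pred nat) (e : 'I_n) :
  count (fun p => J p && bit_mem w p e) P =
  count (fun S : {set 'I_n} => e \in S)
    (mask [seq J (n.+1 * j.+1) | j <- iota 0 M] sets).
Proof.
have ES : sets = map (nth set0 sets) (iota 0 M) by rewrite -/(mkseq _ _) mkseq_nth.
rewrite /set_positions count_map [in RHS]ES size_map size_iota -map_mask -filter_mask.
rewrite count_map count_filter; apply: eq_in_count => j.
by rewrite mem_iota add0n => /andP[_ jM] /=; rewrite bit_mem_enc // andbC.
Qed.

Lemma exact_cover_x3c : exact_cover n P (bit_mem w) <-> x3c_yes I.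
Proof.
split=> [[J HJ]|[T /subseqP[b sb ->] HT]].
  exists (mask [seq J (n.+1 * j.+1) | j <- iota 0 M] sets); first exact: mask_subseq.
  by move=> e; rewrite -count_cover; apply: HJ; apply: ltn_ord.
(* The index j is recovered from its position (n + 1)(j + 1) by division. *)
exists (fun p => nth false b (p %/ n.+1).-1) => e en.
rewrite (@count_cover _ (Ordinal en)) -[RHS](HT (Ordinal en)); congr (count _ (mask _ _)).
rewrite (eq_map (g := nth false b)) => [|j]; last by rewrite mulKn.
by rewrite -sb -/(mkseq _ _) mkseq_nth.
Qed.

End Instance.

(** Every entry costs at least a tag, a sign and the terminator of its digits. *)
Lemma size_enc_vector (alpha : seq int) : 3 * size alpha <= size (enc_vector alpha).
Proof.
rewrite /enc_vector /enc_seq size_cat.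
suff : 3 * size alpha <= size (flatten [seq true :: enc_int x | x <- alpha]) by lia.
elim: alpha => //= z alpha IH; rewrite size_cat mulnS !addSn !ltnS.
rewrite [size (enc_nat _)]size_cat /=; lia.
Qed.

(** * The number of candidates and the reduction map *)

Definition num_cand (I : x3c) : nat := 2 ^ f_exp (size (enc_x3c I)) - 1.

Definition reduction (x : x3c * seq int) : pw :=
  let w := enc_x3c x.1 ++ enc_vector x.2 in
  let n := x3c_n x.1 in
  let P := set_positions n (size (x3c_sets x.1)) in
  let m := (2 ^ f_exp (size (enc_x3c x.1))).+1 in
  @PW m [seq vote_of m (vote_idx P (bit_mem w) t) | t <- indices n P] ord0.

Lemma num_cand_bounds (I : x3c) :
  [/\ num_cand I + 2 = (2 ^ f_exp (size (enc_x3c I))).+1, size (enc_x3c I) <= num_cand I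
    & num_cand I <= 2 * size (enc_x3c I)].
Proof.
have s2 : 2 <= size (enc_x3c I) by rewrite size_enc_x3c; lia.
rewrite /num_cand; move: (size (enc_x3c I)) s2 => s s2.
have gt : s < 2 ^ f_exp s by rewrite ltnNge -ltn_f_exp ltnn.
split; [lia | lia |].
have := @up_log_gtn 2 s.+1 isT ltac:(lia); rewrite -/(f_exp s).
have : 0 < f_exp s by rewrite ltn_f_exp; lia.
by case: (f_exp s) => // k _; rewrite expnS /=; lia.
Qed.

Lemma enc_matrix m (v : level_vote) :
  [seq vote_of m v x y | x <- enum 'I_m, y <- enum 'I_m] =
  [seq nat_rel v x y | x <- iota 0 m, y <- iota 0 m].
Proof. by rewrite -val_enum_ord allpairs_mapl allpairs_mapr. Qed.

Lemma out_reduction (I : x3c) (alpha : seq int) : admissible_vector (num_cand I + 2) alpha ->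
  out (enc_x3c I ++ enc_vector alpha) (fun=> 0) g_prog = enc_pw (reduction (I, alpha)).
Proof.
move=> [[sz _] _ _ _ _]; have [E _ _] := num_cand_bounds I.
rewrite (@out_g_prog _ (x3c_n I) (size (x3c_sets I))).
- rewrite -size_enc_x3c /enc_pw; congr (_ ++ (_ ++ _)).
  rewrite /enc_seq -!map_comp; congr (flatten _ ++ _); apply: eq_map => t.
  by rewrite [RHS]/= enc_matrix /matrix_word -size_enc_x3c.
- exact: onth_enc_pre.
- exact: onth_enc_n.
- exact: onth_enc_set.
- exact: onth_enc_last.
(* The vector has as many entries as there are candidates, so the word is long enough for the
   registers. *)
- have := size_enc_vector alpha; rewrite -size_enc_x3c size_cat sz E; lia.
Qed.

Lemma reduction_correct (I : x3c) (alpha : seq int) :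
  admissible_vector (num_cand I + 2) alpha ->
  pw_m (reduction (I, alpha)) = num_cand I + 2 /\
  (possible_winner alpha (reduction (I, alpha)) <-> x3c_yes I).
Proof.
have [E ge _] := num_cand_bounds I; rewrite E => adm; split=> //.
rewrite -(exact_cover_x3c I (enc_vector alpha)) /reduction /=.
set w := enc_x3c I ++ _; set n := x3c_n I; set M := size (x3c_sets I).
set P := set_positions n M; set m := (2 ^ _).+1 in adm *.
have szw : size (enc_x3c I) = (n.+1 * M.+1).+1 by apply: size_enc_x3c.
have mE : m = num_cand I + 2 by rewrite E.
have n3 (p : nat) : p \in P -> 3 <= n.
  by case/(positionsP I) => j jM _; apply: n_ge3; apply: leq_ltn_trans jM.
have Plt (p : nat) : p \in P -> n < p /\ p < n.+1 * M.+1.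
  by move=> Pp; split; [apply: positions_gt Pp | apply: positions_lt Pp].
have P_uniq : uniq P by apply: (sorted_uniq ltn_trans ltnn); apply: sorted_positions.
have P_gt (p : nat) : p \in P -> n < p by case/Plt.
have P_ge4 (p : nat) : p \in P -> 4 <= p by move=> Pp; have := n3 p Pp; have := P_gt p Pp; lia.
have P_lt (p : nat) : p \in P -> p + 2 < m by case/Plt; lia.
have P_far (p p' : nat) : p \in P -> p' \in P -> p != p' -> (p + 4 <= p') || (p' + 4 <= p).
  move=> Pp Pp'; have := n3 p Pp.
  case/(positionsP I): Pp => j _ ->; case/(positionsP I): Pp' => j' _ -> n3' npp'.
  case: (ltngtP j j') npp' => [lt|lt|->] //; last by rewrite eqxx.
  - have : n.+1 * j.+2 <= n.+1 * j'.+1 by rewrite leq_pmul2l.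
    by rewrite [n.+1 * j.+2]mulnS; lia.
  - have : n.+1 * j'.+2 <= n.+1 * j.+1 by rewrite leq_pmul2l.
    by rewrite [n.+1 * j'.+2]mulnS; lia.
have m_gt4 : 4 < m.
  have : 2 <= f_exp (size (enc_x3c I)) by rewrite ltn_f_exp szw; lia.
  by rewrite /m; case: f_exp => [|[|k]] // _; rewrite !expnS; have := expn_gt0 2 k; lia.
have mem3 : forall p : nat, p \in P -> count (bit_mem w p) (iota 0 n) = 3.
  exact: count_bit_mem.
have [b0 ab] : (0 < alpha`_1)%R /\ (alpha`_1 < alpha`_0 - alpha`_1)%R.
  by case: adm => _ _ E12 [+ E0]; rewrite E0 -E12 => lt lt2; split; lia.
have idx_uniq : uniq (indices n P) by apply: (indices_uniq P_uniq P_gt).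
have proper t : t \in indices n P -> proper_vote m (vote_idx P (bit_mem w) t).
  exact: proper_vote_idx.
have H := possible_winner_outcomes (ltnW (ltnW m_gt4)) adm idx_uniq proper ord0.
apply: (iff_trans H); split=> [[o ov win]|].
- exact: (exact_cover_of_winner P_uniq P_ge4 P_lt P_far mem3 m_gt4 b0 ab ov win).
- exact: (winner_of_exact_cover P_uniq P_ge4 P_lt P_far mem3 m_gt4 b0 ab).
Qed.

Local Open Scope ring_scope.

Theorem theorem4 :
  exists f : x3c -> nat,
    [/\ polytime_on enc_x3c enc_nat (fun _ => True) f,
        exists p : {poly nat}, forall I : x3c, (f I <= p.[size (enc_x3c I)])%N,
        (* m >= 3, so that vectors of the required shape exist *)
        forall I : x3c, (0 < f I)%N
      & exists g : x3c * seq int -> pw,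
          polytime_on (fun x => enc_x3c x.1 ++ enc_vector x.2) enc_pw
            (fun x => admissible_vector (f x.1 + 2) x.2) g
          /\ forall (I : x3c) (alpha : seq int),
               admissible_vector (f I + 2) alpha ->
               pw_m (g (I, alpha)) = (f I + 2)%N
               /\ (possible_winner alpha (g (I, alpha)) <-> x3c_yes I)].
Proof.
have size_enc I : (2 <= size (enc_x3c I))%N by rewrite size_enc_x3c; lia.
exists num_cand; split.
(* 30 exceeds every register in use; [wf_gen] confirms this by evaluation. *)
- apply: (@polytime_gen _ _ _ _ _ _ 30 f_prog) => // I _; first exact: ltnW (size_enc I).
  by rewrite out_f_prog.
- have [p Hp] : poly_bounded (fun s => (2 * s)%N).
    by apply: poly_boundedM; [apply: poly_bounded_const | apply: poly_bounded_id].
  by exists p => I; apply: leq_trans (Hp _); case: (num_cand_bounds I).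
- by move=> I; have [_ le _] := num_cand_bounds I; apply: leq_trans le; apply: ltnW.
- exists reduction; split; last exact: reduction_correct.
  apply: (@polytime_gen _ _ _ _ _ _ 30 g_prog) => // [[I alpha] _ | [I alpha]].
    by rewrite size_cat ltn_addr // ltnW.
  exact: out_reduction.
Qed.
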